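(* Let $\mathbb{K}$ be a field, let $q\in\mathbb{K}^*$ be not a root of unity, let $A=U_q^+(G_2)$, and let $\Omega_1,\Omega_2\in A$ be the central elements defined in the context. Let $(\alpha,\beta)\in\mathbb{K}^2\setminus\{(0,0)\}$. Then the prime ideal $\langle \Omega_1-\alpha,\Omega_2-\beta\rangle$ of $A$ is a maximal (two-sided) ideal of $A$.
   Context: $A=U_q^+(G_2)$ is the $\mathbb{K}$-algebra generated by $E_1,\dots,E_6$ with defining relations \begin{align*} &E_2E_1=q^{-3}E_1E_2,\quad E_3E_1=q^{-1}E_1E_3-(q+q^{-1}+q^{-3})E_2,\quad E_3E_2=q^{-3}E_2E_3,\\ &E_4E_1=E_1E_4+(1-q^2)E_3^2,\quad E_4E_2=q^{-3}E_2E_4-\tfrac{q^4-2q^2+1}{q^4+q^2+1}E_3^3,\quad E_4E_3=q^{-3}E_3E_4,\\ &E_5E_1=qE_1E_5-(1+q^2)E_3,\quad E_5E_2=E_2E_5+(1-q^2)E_3^2,\\ &E_5E_3=q^{-1}E_3E_5-(q+q^{-1}+q^{-3})E_4,\quad E_5E_4=q^{-3}E_4E_5,\\ &E_6E_1=q^3E_1E_6-q^3E_5,\quad E_6E_2=q^3E_2E_6+(q^4+q^2-1)E_4+(q^2-q^4)E_3E_5,\\ &E_6E_3=E_3E_6+(1-q^2)E_5^2,\quad E_6E_4=q^{-3}E_4E_6-\tfrac{q^4-2q^2+1}{q^4+q^2+1}E_5^3,\quad E_6E_5=q^{-3}E_5E_6. \end{align*} It is a noetherian domain and the monomials $E_1^{k_1}\cdots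 E_6^{k_6}$ ($k_i\in\mathbb{N}$) form a $\mathbb{K}$-basis. Define the central elements \begin{align*} \Omega_1&=E_1E_3E_5+aE_1E_4+aE_2E_5+a'E_3^2,\\ \Omega_2&=E_2E_4E_6+bE_2E_5^3+bE_3^3E_6+b'E_3^2E_5^2+c'E_3E_4E_5+d'E_4^2, \end{align*} where $a=\frac{q^2+1+q^{-2}}{q^{-2}-1}$, $a'=\frac{q^6}{q^2-1}$, $b=-\frac{q^7-2q^5+q^3}{(q^4+q^2+1)(1-q^{-6})}$, $b'=\frac{q^{13}-q^{11}}{(q^4+q^2+1)^2}$, $c'=-\frac{q^9}{q^4+q^2+1}$, $d'=\frac{q^{12}}{q^6-1}$. $\langle\cdot\rangle$ denotes the two-sided ideal generated. *)

(* Defs.v *)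
From HB Require Import structures.
From mathcomp Require Import all_boot all_order all_algebra.
From mathcomp Require Import boolp classical_sets.
From mathcomp Require Import monalg.

Set Implicit Arguments.
Unset Strict Implicit.
Unset Printing Implicit Defensive.

Import GRing.Theory.

Local Open Scope ring_scope.
Local Open Scope quotient_scope.

(* Two-sided ideals. The ideals of ring_quotient are one-sided, and it only
   makes the quotient a ring when the base ring is commutative. *)

Section TwoSidedIdeals.
Local Open Scope classical_set_scope.
Variable R : pzRingType.
Implicit Types (I J S : set R).

Definition two_sided_ideal I : Prop :=
  [/\ I 0, forall x y, I x -> I y -> I (x + y),
      forall a x, I x -> I (a * x) & forall a x, I x -> I (x * a)].

Definition ideal_gen S : set R := smallest two_sided_ideal S.

(* Primeness in the sense of noncommutative rings: a condition on products of
   ideals, not of elements. *)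
Definition prime_two_sided_ideal I : Prop :=
  [/\ two_sided_ideal I, I <> setT &
      forall J1 J2, two_sided_ideal J1 -> two_sided_ideal J2 ->
        (forall x y, J1 x -> J2 y -> I (x * y)) -> J1 `<=` I \/ J2 `<=` I].

Definition maximal_two_sided_ideal I : Prop :=
  [/\ two_sided_ideal I, I <> setT &
      forall J, two_sided_ideal J -> I `<=` J -> J = I \/ J = setT].

Lemma ideal_genP S : two_sided_ideal (ideal_gen S).
Proof.
split.
- by move=> I II; have [[]] := II.
- move=> x y Ix Iy I II; have [[_ D _ _] _] := II.
  by apply: D; [exact: Ix | exact: Iy].
- by move=> a x Ix I II; have [[_ _ M _] _] := II; apply: M; exact: Ix.
- by move=> a x Ix I II; have [[_ _ _ M] _] := II; apply: M; exact: Ix.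
Qed.

End TwoSidedIdeals.

Lemma malg_scalerAr (M : monomType) (K : fieldType) c (x y : {malg K[M]}) :
  c *: (x * y) = x * (c *: y).
Proof.
have comm : c%:MP * x = x * c%:MP.
  rewrite !malgM_def fgmulUg fgmulgU; apply/eq_bigr => k _.
  by rewrite mul1m mulm1 mulrC.
by rewrite -!mul_malgC !mulrA comm.
Qed.

Section UqG2.
Variables (K : fieldType) (q : K).

Section Expressions.
Variables (B : lalgType K) (E : 'I_6 -> B).

(* The index i : 'I_6 stands for the generator E_(i + 1). *)
Local Notation E1 := (E (@Ordinal 6 0 isT)).
Local Notation E2 := (E (@Ordinal 6 1 isT)).
Local Notation E3 := (E (@Ordinal 6 2 isT)).
Local Notation E4 := (E (@Ordinal 6 3 isT)).
Local Notation E5 := (E (@Ordinal 6 4 isT)).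
Local Notation E6 := (E (@Ordinal 6 5 isT)).

Definition UqG2_relations : seq (B * B) := [::
  (E2 * E1, q ^- 3 *: (E1 * E2));
  (E3 * E1, q^-1 *: (E1 * E3) - (q + q^-1 + q ^- 3) *: E2);
  (E3 * E2, q ^- 3 *: (E2 * E3));
  (E4 * E1, E1 * E4 + (1 - q ^+ 2) *: E3 ^+ 2);
  (E4 * E2, q ^- 3 *: (E2 * E4)
     - ((q ^+ 4 - 2 * q ^+ 2 + 1) / (q ^+ 4 + q ^+ 2 + 1)) *: E3 ^+ 3);
  (E4 * E3, q ^- 3 *: (E3 * E4));
  (E5 * E1, q *: (E1 * E5) - (1 + q ^+ 2) *: E3);
  (E5 * E2, E2 * E5 + (1 - q ^+ 2) *: E3 ^+ 2);
  (E5 * E3, q^-1 *: (E3 * E5) - (q + q^-1 + q ^- 3) *: E4);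
  (E5 * E4, q ^- 3 *: (E4 * E5));
  (E6 * E1, q ^+ 3 *: (E1 * E6) - q ^+ 3 *: E5);
  (E6 * E2, q ^+ 3 *: (E2 * E6) + (q ^+ 4 + q ^+ 2 - 1) *: E4
     + (q ^+ 2 - q ^+ 4) *: (E3 * E5));
  (E6 * E3, E3 * E6 + (1 - q ^+ 2) *: E5 ^+ 2);
  (E6 * E4, q ^- 3 *: (E4 * E6)
     - ((q ^+ 4 - 2 * q ^+ 2 + 1) / (q ^+ 4 + q ^+ 2 + 1)) *: E5 ^+ 3);
  (E6 * E5, q ^- 3 *: (E5 * E6))].

Lemma UqG2_relations_closed (P : B -> Prop) :
    (forall i, P (E i)) ->
    (forall x y, P x -> P y -> P (x - y)) ->
    (forall x y, P x -> P y -> P (x + y)) ->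
    (forall c x, P x -> P (c *: x)) ->
    (forall x y, P x -> P y -> P (x * y)) ->
  forall r, r \in UqG2_relations -> P r.1 /\ P r.2.
Proof.
move=> PE PB PD PZ PM r.
have PX n x : P x -> P (x ^+ n.+1).
  by move=> Px; elim: n => [|n IHn]; rewrite ?expr1 // exprS; apply: PM.
rewrite !inE; do ?[case/orP]; move/eqP=> -> /=; split;
  by repeat (exact: PE || apply: (PX) || apply: (PM) || apply: (PZ)
             || apply: (PB) || apply: (PD)).
Qed.

Definition Omega1_expr : B :=
  let a := (q ^+ 2 + 1 + q ^- 2) / (q ^- 2 - 1) in
  let a' := q ^+ 6 / (q ^+ 2 - 1) in
  E1 * E3 * E5 + a *: (E1 * E4) + a *: (E2 * E5) + a' *: E3 ^+ 2.

Definition Omega2_expr : B :=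
  let b := - ((q ^+ 7 - 2 * q ^+ 5 + q ^+ 3)
              / ((q ^+ 4 + q ^+ 2 + 1) * (1 - q ^- 6))) in
  let b' := (q ^+ 13 - q ^+ 11) / (q ^+ 4 + q ^+ 2 + 1) ^+ 2 in
  let c' := - (q ^+ 9 / (q ^+ 4 + q ^+ 2 + 1)) in
  let d' := q ^+ 12 / (q ^+ 6 - 1) in
  E2 * E4 * E6 + b *: (E2 * E5 ^+ 3) + b *: (E3 ^+ 3 * E6)
  + b' *: (E3 ^+ 2 * E5 ^+ 2) + c' *: (E3 * E4 * E5) + d' *: E4 ^+ 2.

End Expressions.

(* {malg K[{fmonom 'I_6}]} is the free associative K-algebra on 6 letters. *)
Local Notation UqG2_free := {malg K[{fmonom 'I_6}]}.

Definition UqG2_letter (i : 'I_6) : UqG2_free := << fmu i >>.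

Definition UqG2_kernel : set UqG2_free :=
  ideal_gen [set r.1 - r.2 | r in [set` UqG2_relations UqG2_letter]]%classic.

Definition UqG2_kernel_pred : {pred UqG2_free} := fun x => `[< UqG2_kernel x >].

Lemma UqG2_kernel_predE x : x \in UqG2_kernel_pred <-> UqG2_kernel x.
Proof. by split=> [/asboolP|?]; last apply/asboolP. Qed.

Fact UqG2_kernel_zmod : zmod_closed UqG2_kernel_pred.
Proof.
have [k0 kD kM _] := ideal_genP
  [set r.1 - r.2 | r in [set` UqG2_relations UqG2_letter]]%classic.
split=> [|x y /UqG2_kernel_predE kx /UqG2_kernel_predE ky].
  exact/UqG2_kernel_predE.
by apply/UqG2_kernel_predE; rewrite -mulN1r; apply: kD => //; apply: kM.
Qed.

HB.instance Definition _ :=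
  GRing.isZmodClosed.Build UqG2_free UqG2_kernel_pred UqG2_kernel_zmod.

Definition UqG2 : Type := Quotient.quot UqG2_kernel_pred.
HB.instance Definition _ := GRing.Zmodule.on UqG2.

Definition UqG2_pi (x : UqG2_free) : UqG2 :=
  \pi_(Quotient.quot UqG2_kernel_pred) x.
Definition UqG2_repr (x : UqG2) : UqG2_free :=
  repr (x : Quotient.quot UqG2_kernel_pred).

Lemma UqG2_reprK : cancel UqG2_repr UqG2_pi.
Proof. by move=> x; rewrite /UqG2_pi /UqG2_repr reprK. Qed.

Lemma UqG2_piP x y : UqG2_pi x = UqG2_pi y <-> UqG2_kernel (x - y).
Proof.
rewrite -UqG2_kernel_predE Quotient.idealrBE.
by split=> [/eqP|/eqP].
Qed.

Fact UqG2_pi_is_zmod_morphism : zmod_morphism UqG2_pi.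
Proof. by move=> x y; rewrite /UqG2_pi raddfB. Qed.

HB.instance Definition _ :=
  GRing.isZmodMorphism.Build UqG2_free UqG2 UqG2_pi UqG2_pi_is_zmod_morphism.

Definition UqG2_one : UqG2 := UqG2_pi 1.
Definition UqG2_mul (x y : UqG2) : UqG2 := UqG2_pi (UqG2_repr x * UqG2_repr y).
Definition UqG2_scale (c : K) (x : UqG2) : UqG2 := UqG2_pi (c *: UqG2_repr x).

Lemma UqG2_kernel_repr x : UqG2_kernel (UqG2_repr (UqG2_pi x) - x).
Proof. by apply/UqG2_piP; rewrite UqG2_reprK. Qed.

Lemma UqG2_piM x y : UqG2_mul (UqG2_pi x) (UqG2_pi y) = UqG2_pi (x * y).
Proof.
have [_ kD kl kr] := ideal_genP
  [set r.1 - r.2 | r in [set` UqG2_relations UqG2_letter]]%classic.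
apply/UqG2_piP; set x' := UqG2_repr _; set y' := UqG2_repr _.
have -> : x' * y' - x * y = (x' - x) * y' + x * (y' - y).
  by rewrite mulrBl mulrBr addrA subrK.
by apply: kD; [apply: kr | apply: kl]; apply: UqG2_kernel_repr.
Qed.

Lemma UqG2_piZ c x : UqG2_scale c (UqG2_pi x) = UqG2_pi (c *: x).
Proof.
have [_ _ kl _] := ideal_genP
  [set r.1 - r.2 | r in [set` UqG2_relations UqG2_letter]]%classic.
apply/UqG2_piP; rewrite -scalerBr -[_ - x]mul1r scalerAl.
by apply: kl; apply: UqG2_kernel_repr.
Qed.

Fact UqG2_mulA : associative UqG2_mul.
Proof.
move=> x y z; rewrite -[x]UqG2_reprK -[y]UqG2_reprK -[z]UqG2_reprK.
by rewrite !UqG2_piM mulrA.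
Qed.

Fact UqG2_mul1 : left_id UqG2_one UqG2_mul.
Proof. by move=> x; rewrite -[x]UqG2_reprK UqG2_piM mul1r. Qed.

Fact UqG2_mulr1 : right_id UqG2_one UqG2_mul.
Proof. by move=> x; rewrite -[x]UqG2_reprK UqG2_piM mulr1. Qed.

Fact UqG2_mulDl : left_distributive UqG2_mul +%R.
Proof.
move=> x y z; rewrite -[x]UqG2_reprK -[y]UqG2_reprK -[z]UqG2_reprK.
by rewrite -raddfD !UqG2_piM -raddfD mulrDl.
Qed.

Fact UqG2_mulDr : right_distributive UqG2_mul +%R.
Proof.
move=> x y z; rewrite -[x]UqG2_reprK -[y]UqG2_reprK -[z]UqG2_reprK.
by rewrite -raddfD !UqG2_piM -raddfD mulrDr.
Qed.

(* No relator has a constant term, so neither has any element of the kernel. *)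
Lemma UqG2_kernel_aug x : UqG2_kernel x -> x@_mone = 0.
Proof.
move=> kx; apply: (kx [set y : UqG2_free | y@_mone = 0]%classic); split.
  split=> /=.
  - exact: mcoeff0.
  - by move=> y z y0 z0; rewrite mcoeffD y0 z0 addr0.
  - by move=> a y y0; rewrite rmorphM /= y0 mulr0.
  - by move=> a y y0; rewrite rmorphM /= y0 mul0r.
have gen0 i : (UqG2_letter i)@_mone = 0.
  rewrite mcoeffU; case: eqP => // e1.
  by have := congr1 (@fmonom_val _) e1; rewrite fmuE /= fm1.
have mM (y z : UqG2_free) : (y * z)@_mone = y@_mone * z@_mone.
  by rewrite rmorphM.
move=> _ [r /= rin <-].
have [r1 r2] : (r.1)@_mone = 0 /\ (r.2)@_mone = 0; last first.
  by rewrite mcoeffB r1 r2 subr0.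
apply: (UqG2_relations_closed (P := fun y => y@_mone = 0) _ _ _ _ _ rin) => //.
- by move=> y z y0 z0; rewrite mcoeffB y0 z0 subr0.
- by move=> y z y0 z0; rewrite mcoeffD y0 z0 addr0.
- by move=> c y y0; rewrite mcoeffZ y0 mulr0.
- by move=> y z y0 z0; rewrite mM y0 mul0r.
Qed.

Fact UqG2_one_neq0 : UqG2_one != 0.
Proof.
apply/eqP; rewrite -(raddf0 UqG2_pi) => /UqG2_piP /UqG2_kernel_aug /eqP.
by rewrite subr0 rmorph1 oner_eq0.
Qed.

HB.instance Definition _ := GRing.Zmodule_isNzRing.Build UqG2
  UqG2_mulA UqG2_mul1 UqG2_mulr1 UqG2_mulDl UqG2_mulDr UqG2_one_neq0.

Fact UqG2_scaleA c d x : UqG2_scale c (UqG2_scale d x) = UqG2_scale (c * d) x.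
Proof. by rewrite -[x]UqG2_reprK !UqG2_piZ scalerA. Qed.

Fact UqG2_scale1 : left_id 1 UqG2_scale.
Proof. by move=> x; rewrite -[x]UqG2_reprK UqG2_piZ scale1r. Qed.

Fact UqG2_scaleDr : right_distributive UqG2_scale +%R.
Proof.
move=> c x y; rewrite -[x]UqG2_reprK -[y]UqG2_reprK.
by rewrite -raddfD !UqG2_piZ -raddfD scalerDr.
Qed.

Fact UqG2_scaleDl x : {morph UqG2_scale^~ x : c d / c + d}.
Proof.
by move=> c d; rewrite -[x]UqG2_reprK !UqG2_piZ -raddfD scalerDl.
Qed.

HB.instance Definition _ := GRing.Zmodule_isLmodule.Build K UqG2
  UqG2_scaleA UqG2_scale1 UqG2_scaleDr UqG2_scaleDl.

Fact UqG2_scaleAl c (x y : UqG2) : c *: (x * y) = (c *: x) * y.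
Proof.
suff : UqG2_scale c (UqG2_mul x y) = UqG2_mul (UqG2_scale c x) y by [].
rewrite -[x]UqG2_reprK -[y]UqG2_reprK.
by rewrite UqG2_piM !UqG2_piZ UqG2_piM scalerAl.
Qed.

HB.instance Definition _ := GRing.Lmodule_isLalgebra.Build K UqG2 UqG2_scaleAl.

Fact UqG2_scaleAr c (x y : UqG2) : c *: (x * y) = x * (c *: y).
Proof.
suff : UqG2_scale c (UqG2_mul x y) = UqG2_mul x (UqG2_scale c y) by [].
rewrite -[x]UqG2_reprK -[y]UqG2_reprK.
by rewrite UqG2_piM !UqG2_piZ UqG2_piM malg_scalerAr.
Qed.

HB.instance Definition _ := GRing.Lalgebra_isAlgebra.Build K UqG2 UqG2_scaleAr.

Fact UqG2_pi_is_monoid_morphism : monoid_morphism UqG2_pi.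
Proof. by split=> [|x y]; [reflexivity | exact: (esym (UqG2_piM x y))]. Qed.

HB.instance Definition _ :=
  GRing.isMonoidMorphism.Build UqG2_free UqG2 UqG2_pi
    UqG2_pi_is_monoid_morphism.

Fact UqG2_pi_is_scalable : scalable UqG2_pi.
Proof. by move=> c x; exact: (esym (UqG2_piZ c x)). Qed.

HB.instance Definition _ :=
  GRing.isScalable.Build K UqG2_free UqG2 *:%R UqG2_pi UqG2_pi_is_scalable.

Definition UqG2_gen (i : 'I_6) : UqG2 := UqG2_pi (UqG2_letter i).

Definition Omega1 : UqG2 := Omega1_expr UqG2_gen.
Definition Omega2 : UqG2 := Omega2_expr UqG2_gen.

End UqG2.

(* Main.v *)
(** Let [A] be [U_q^+(G_2)] and [I] the ideal generated by [Omega1 - alpha] and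
    [Omega2 - beta]. The quantum minors [F = [3,5]] and [G = [2,4]] together
    with [E3] and [E4] form a q-commuting seed, in which every generator is,
    modulo [I], a Laurent polynomial.

    Let [P] be a maximal ideal containing [I]. No power of a seed element lies
    in [P]: commutators with suitable generators would bring down first a power
    of [F] and then, since [A F + A [E1, F]] is a two-sided ideal, [F] itself
    to [P], hence also [Omega1] and [Omega2], against [(alpha, beta) <> 0].
    Since the powers of each seed element form an Ore set, the seed elements
    are regular modulo [P]; as the monomials in the seed have distinct
    commutation characters, they are linearly independent modulo [P]. Clearing
    denominators, every [x] in [P] satisfies [m x \in I] for some monomial [m]
    in the seed, and a single [m] works for all of [P] because [A] is right
    noetherian. The ideal of all [a] with [a P <= I] then contains [I] and [m],
    so it lies in no maximal ideal; therefore it contains [1], and [P = I].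

    Finally [I] is proper, because the Laurent expansions of the generators
    define an action of [A] on the functions on [Z^2] in which [Omega1] and
    [Omega2] act as [alpha] and [beta]. *)

Require Import Defs.
From Stdlib Require Import ZArith.
From HB Require Import structures.
From mathcomp Require Import all_boot all_order all_algebra.
From mathcomp Require Import boolp classical_sets.
From mathcomp Require Import finmap monalg.
From mathcomp Require Import zify ring.

Set Implicit Arguments.
Unset Strict Implicit.
Unset Printing Implicit Defensive.

Import GRing.Theory.
Local Open Scope ring_scope.

(** * Normal forms of noncommutative polynomials *)

Section LinearCombinations.
Variables (K : fieldType) (V : lmodType K) (I : eqType) (mon : I -> V).
Implicit Types l : seq (K * I).

Definition lincomb l : V := \sum_(p <- l) p.1 *: mon p.2.
Definition lincoef l (i : I) : K := \sum_(p <- l | p.2 == i) p.1.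

(** Merging repeated indices turns an arbitrary list into a duplicate-free family, the form to which
    linear independence applies. *)
Lemma lincomb_collect l :
  lincomb l = \sum_(i <- undup (map snd l)) lincoef l i *: mon i.
Proof.
under eq_bigr do rewrite scaler_suml.
rewrite (exchange_big_dep predT) //=; apply: eq_big_seq => p pl.
have pi : p.2 \in undup (map snd l) by rewrite mem_undup map_f.
rewrite big_mkcond (bigD1_seq p.2) ?undup_uniq //= eqxx big1 ?addr0 // => i.
by rewrite eq_sym => /negPf ->.
Qed.

End LinearCombinations.

Section Expressions.
Variables (K : fieldType) (B : lalgType K) (g : nat -> B).

Inductive ncexpr :=
  | NcOne | NcGen of nat | NcAdd of ncexpr & ncexpr | NcOpp of ncexpr
  | NcMul of ncexpr & ncexpr | NcScale of K & ncexpr | NcPow of ncexpr & nat.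

Fixpoint ncdenote e : B := match e with
  | NcOne => 1
  | NcGen k => g k
  | NcAdd e f => ncdenote e + ncdenote f
  | NcOpp e => - ncdenote e
  | NcMul e f => ncdenote e * ncdenote f
  | NcScale c e => c *: ncdenote e
  | NcPow e n => ncdenote e ^+ n
  end.

End Expressions.

(* Normalisation of noncommutative polynomials by a rewriting system that
   straightens one descent at a time; words are lists of naturals, and the
   operations on coefficients are wrapped so that evaluating the procedure
   leaves the arithmetic of [K] folded. *)
Section Straightening.
Variables (K : fieldType) (B : algType K) (g : nat -> B).
Definition cadd (x y : K) := x + y.
Definition cmul (x y : K) := x * y.
Definition copp (x : K) := - x.
Definition cone : K := 1.
Definition ncpoly := seq (K * seq nat).
Variable rule : nat -> nat -> ncpoly.

Fixpoint eqword (u v : seq nat) := match u, v with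
  | [::], [::] => true
  | a :: u', b :: v' => if Nat.eqb a b then eqword u' v' else false
  | _, _ => false
  end.

Fixpoint addmon c w (p : ncpoly) : ncpoly := match p with
  | [::] => [:: (c, w)]
  | (d, v) :: p' => if eqword w v then (cadd c d, v) :: p'
                    else (d, v) :: addmon c w p'
  end.

Fixpoint scalemon c w (p : ncpoly) : ncpoly := match p with
  | [::] => [::]
  | (d, v) :: p' => (cmul c d, cat w v) :: scalemon c w p'
  end.

Fixpoint mulpoly (p r : ncpoly) : ncpoly := match p with
  | [::] => [::]
  | (c, w) :: p' => cat (scalemon c w r) (mulpoly p' r)
  end.

Fixpoint powpoly (p : ncpoly) n : ncpoly := match n with
  | 0 => [:: (cone, [::])]
  | n'.+1 => mulpoly p (powpoly p n')
  end.

Fixpoint expand (e : ncexpr K) : ncpoly := match e with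
  | NcOne => [:: (cone, [::])]
  | NcGen k => [:: (cone, [:: k])]
  | NcAdd e f => cat (expand e) (expand f)
  | NcOpp e => scalemon (copp cone) [::] (expand e)
  | NcMul e f => mulpoly (expand e) (expand f)
  | NcScale c e => scalemon c [::] (expand e)
  | NcPow e n => powpoly (expand e) n
  end.

Fixpoint rcatmon (p : ncpoly) w : ncpoly := match p with
  | [::] => [::]
  | (d, v) :: p' => (d, cat v w) :: rcatmon p' w
  end.

Fixpoint rewrite_descent (w : seq nat) : option ncpoly := match w with
  | a :: w' => match w' with
    | b :: w'' =>
      if Nat.ltb b a then Some (rcatmon (rule a b) w'')
      else match rewrite_descent w' with
           | Some p => Some (scalemon cone [:: a] p)
           | None => None
           end
    | [::] => None
    end
  | [::] => None
  end.

Fixpoint addpoly c (p r : ncpoly) : ncpoly := match p with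
  | [::] => r
  | (d, v) :: p' => addmon (cmul c d) v (addpoly c p' r)
  end.

(** When the fuel runs out the pending terms are returned unchanged, so the value is preserved
    whatever the fuel, independently of termination. *)
Fixpoint normalize fuel (todo acc : ncpoly) : ncpoly := match fuel with
  | 0 => cat todo acc
  | n.+1 => match todo with
    | [::] => acc
    | (c, w) :: p =>
      match rewrite_descent w with
      | Some r => normalize n (addpoly c r p) acc
      | None => normalize n p (addmon c w acc)
      end
    end
  end.

(** A proposition rather than a boolean test: the coefficients are rational expressions in [q], and
    each equation is left for [field]. *)
Fixpoint allzero (p : ncpoly) : Prop := match p with
  | [::] => True
  | (c, _) :: p' => c = 0 /\ allzero p'
  end.

Definition wordval (w : seq nat) : B := \prod_(k <- w) g k.
Definition polyval (p : ncpoly) : B := lincomb wordval p.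

Lemma wordval_cat u v : wordval (u ++ v) = wordval u * wordval v.
Proof. exact: big_cat. Qed.

Lemma wordval_cons a u : wordval (a :: u) = g a * wordval u.
Proof. exact: big_cons. Qed.

Lemma polyval_cons c w p : polyval ((c, w) :: p) = c *: wordval w + polyval p.
Proof. exact: big_cons. Qed.

Lemma polyval_nil : polyval [::] = 0.
Proof. exact: big_nil. Qed.

Lemma polyval_cat p r : polyval (p ++ r) = polyval p + polyval r.
Proof. exact: big_cat. Qed.

Lemma eqwordP u v : eqword u v -> u = v.
Proof.
elim: u v => [|a u IHu] [|b v] //=.
by case: PeanoNat.Nat.eqb_spec => // -> /IHu ->.
Qed.

Lemma polyval_addmon c w p : polyval (addmon c w p) = c *: wordval w + polyval p.
Proof.
elim: p => [|[d v] p IHp] /=; first by rewrite polyval_cons.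
case: ifP => [/eqwordP->|_]; rewrite !polyval_cons; first by rewrite scalerDl addrA.
by rewrite IHp addrCA.
Qed.

Lemma polyval_scalemon c w p : polyval (scalemon c w p) = c *: (wordval w * polyval p).
Proof.
elim: p => [|[d v] p IHp] /=; first by rewrite polyval_nil mulr0 scaler0.
rewrite !polyval_cons IHp wordval_cat mulrDr scalerDr; congr (_ + _).
by rewrite -scalerAr scalerA.
Qed.

Lemma polyval_mul p r : polyval (mulpoly p r) = polyval p * polyval r.
Proof.
elim: p => [|[c w] p IHp] /=; first by rewrite polyval_nil mul0r.
by rewrite polyval_cat polyval_cons polyval_scalemon IHp mulrDl scalerAl.
Qed.

Lemma polyval_one : polyval [:: (cone, [::])] = 1.
Proof. by rewrite polyval_cons polyval_nil addr0 scale1r /wordval big_nil. Qed.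

Lemma polyval_expand e : polyval (expand e) = ncdenote g e.
Proof.
elim: e => [|k|e IHe f IHf|e IHe|e IHe f IHf|c e IHe|e IHe n] /=.
- exact: polyval_one.
- by rewrite polyval_cons polyval_nil addr0 scale1r /wordval big_seq1.
- by rewrite polyval_cat IHe IHf.
- by rewrite polyval_scalemon /wordval big_nil mul1r IHe scaleN1r.
- by rewrite polyval_mul IHe IHf.
- by rewrite polyval_scalemon /wordval big_nil mul1r IHe.
- elim: n => [|n IHn] /=; first exact: polyval_one.
  by rewrite polyval_mul IHn IHe exprS.
Qed.

Lemma polyval_rcatmon p w : polyval (rcatmon p w) = polyval p * wordval w.
Proof.
elim: p => [|[d v] p IHp] /=; first by rewrite polyval_nil mul0r.
by rewrite !polyval_cons IHp mulrDl wordval_cat scalerAl.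
Qed.

Lemma polyval_addpoly c p r : polyval (addpoly c p r) = c *: polyval p + polyval r.
Proof.
elim: p => [|[d v] p IHp] /=; first by rewrite polyval_nil scaler0 add0r.
by rewrite polyval_addmon IHp polyval_cons scalerDr scalerA addrA.
Qed.

Hypothesis ruleP : forall a b, (b < a)%N -> g a * g b = polyval (rule a b).

Lemma rewrite_descentP w p : rewrite_descent w = Some p -> wordval w = polyval p.
Proof.
elim: w p => [|a [|b w] IHw] p //.
have -> : rewrite_descent [:: a, b & w] =
    if Nat.ltb b a then Some (rcatmon (rule a b) w)
    else if rewrite_descent (b :: w) is Some p then Some (scalemon cone [:: a] p)
    else None by [].
case: PeanoNat.Nat.ltb_spec => [/ltP ba [<-]|_].
  by rewrite polyval_rcatmon -ruleP // !wordval_cons mulrA.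
case: (rewrite_descent _) IHw => // r /(_ _ erefl) E [<-].
by rewrite wordval_cons E polyval_scalemon scale1r /wordval big_seq1.
Qed.

Lemma polyval_normalize fuel todo acc :
  polyval (normalize fuel todo acc) = polyval todo + polyval acc.
Proof.
elim: fuel todo acc => [|n IHn] todo acc /=; first exact: polyval_cat.
case: todo => [|[c w] p]; first by rewrite polyval_nil add0r.
case E: rewrite_descent => [r|]; rewrite IHn polyval_cons.
  by rewrite polyval_addpoly (rewrite_descentP E).
by rewrite polyval_addmon addrCA addrA.
Qed.

Lemma allzeroP p : allzero p -> polyval p = 0.
Proof.
elim: p => [|[c w] p IHp] /=; first by rewrite polyval_nil.
by case=> -> /IHp E; rewrite polyval_cons E scale0r addr0.
Qed.

Lemma nc_eq0 fuel e : allzero (normalize fuel (expand e) [::]) -> ncdenote g e = 0.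
Proof. by move/allzeroP; rewrite polyval_normalize polyval_nil addr0 polyval_expand. Qed.

End Straightening.

(** * The straightening rules of [U_q^+(G_2)] *)

Section Letters.
Variables (K : fieldType) (B : lalgType K) (E : 'I_6 -> B).

(** Reified words are indexed by [nat]; every index from 5 on denotes the sixth generator. *)
Definition letter (k : nat) : B := match k with
  | 0 => E (@Ordinal 6 0 isT) | 1 => E (@Ordinal 6 1 isT)
  | 2 => E (@Ordinal 6 2 isT) | 3 => E (@Ordinal 6 3 isT)
  | 4 => E (@Ordinal 6 4 isT) | _ => E (@Ordinal 6 5 isT)
  end.

End Letters.

Section Relations.
Variables (K : fieldType) (q : K) (B : algType K) (E : 'I_6 -> B).

Local Notation h := (q ^+ 4 + q ^+ 2 + 1).
Local Notation s := (q + q^-1 + q ^- 3).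

(** Letters are numbered from 0. A pair outside the table falls into the last case, which leaves the
    product as it is, so that [uq_ruleP] holds for all pairs. *)
Definition uq_rule (a b : nat) : ncpoly K := match a, b with
  | 1%N, 0%N => [:: (q ^- 3, [:: 0; 1]%N)]
  | 2%N, 0%N => [:: (q^-1, [:: 0; 2]%N); (- s, [:: 1]%N)]
  | 2%N, 1%N => [:: (q ^- 3, [:: 1; 2]%N)]
  | 3%N, 0%N => [:: (1, [:: 0; 3]%N); (1 - q ^+ 2, [:: 2; 2]%N)]
  | 3%N, 1%N => [:: (q ^- 3, [:: 1; 3]%N);
                (- ((q ^+ 4 - 2 * q ^+ 2 + 1) / h), [:: 2; 2; 2]%N)]
  | 3%N, 2%N => [:: (q ^- 3, [:: 2; 3]%N)]
  | 4%N, 0%N => [:: (q, [:: 0; 4]%N); (- (1 + q ^+ 2), [:: 2]%N)]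
  | 4%N, 1%N => [:: (1, [:: 1; 4]%N); (1 - q ^+ 2, [:: 2; 2]%N)]
  | 4%N, 2%N => [:: (q^-1, [:: 2; 4]%N); (- s, [:: 3]%N)]
  | 4%N, 3%N => [:: (q ^- 3, [:: 3; 4]%N)]
  | 5%N, 0%N => [:: (q ^+ 3, [:: 0; 5]%N); (- q ^+ 3, [:: 4]%N)]
  | 5%N, 1%N => [:: (q ^+ 3, [:: 1; 5]%N); (q ^+ 4 + q ^+ 2 - 1, [:: 3]%N);
                (q ^+ 2 - q ^+ 4, [:: 2; 4]%N)]
  | 5%N, 2%N => [:: (1, [:: 2; 5]%N); (1 - q ^+ 2, [:: 4; 4]%N)]
  | 5%N, 3%N => [:: (q ^- 3, [:: 3; 5]%N);
                (- ((q ^+ 4 - 2 * q ^+ 2 + 1) / h), [:: 4; 4; 4]%N)]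
  | 5%N, 4%N => [:: (q ^- 3, [:: 4; 5]%N)]
  | _, _ => [:: (1, [:: a; b])]
  end.

Hypothesis Erel : forall r, r \in UqG2_relations q E -> r.1 = r.2.

Lemma uq_ruleP a b : letter E a * letter E b = polyval (letter E) (uq_rule a b).
Proof.
have w1 k : wordval (letter E) [:: k] = letter E k by exact: big_seq1.
have w2 k l : wordval (letter E) [:: k; l] = letter E k * letter E l.
  by rewrite wordval_cons w1.
have w3 k : wordval (letter E) [:: k; k; k] = letter E k ^+ 3.
  by rewrite 2!wordval_cons w1 !exprS expr0 mulr1.
have trivial_rule c d :
    letter E c * letter E d = polyval (letter E) [:: (1, [:: c; d])].
  by rewrite polyval_cons polyval_nil addr0 scale1r w2.
have rel k : (k < 15)%N ->
    (nth (0, 0) (UqG2_relations q E) k).1 = (nth (0, 0) (UqG2_relations q E) k).2.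
  by move=> k15; apply: Erel; rewrite mem_nth.
move: (rel 0%N isT) (rel 1%N isT) (rel 2%N isT) (rel 3%N isT) (rel 4%N isT)
  (rel 5%N isT) (rel 6%N isT) (rel 7%N isT) (rel 8%N isT) (rel 9%N isT)
  (rel 10%N isT) (rel 11%N isT) (rel 12%N isT) (rel 13%N isT) (rel 14%N isT).
rewrite /= => *.
case: a => [|[|[|[|[|[|a]]]]]]; case: b => [|[|[|[|[|[|b]]]]]] //=;
  rewrite ?trivial_rule // !polyval_cons polyval_nil ?w1 ?w3 ?w2;
  rewrite ?addr0 ?scale1r ?scaleNr ?addrA -?expr2 //.
Qed.

Lemma uq_nc_eq0 fuel e :
  allzero (normalize uq_rule fuel (expand e) [::]) -> ncdenote (letter E) e = 0.
Proof. by apply: nc_eq0 => a b _; apply: uq_ruleP. Qed.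

End Relations.

Ltac nc_quote K t := lazymatch t with
  | 1%R => constr:(@NcOne K)
  | (?x + ?y)%R => let a := nc_quote K x in let b := nc_quote K y in
                   constr:(@NcAdd K a b)
  | (- ?x)%R => let a := nc_quote K x in constr:(@NcOpp K a)
  | (?x * ?y)%R => let a := nc_quote K x in let b := nc_quote K y in
                   constr:(@NcMul K a b)
  | (?c *: ?x)%R => let a := nc_quote K x in constr:(@NcScale K c a)
  | (?x ^+ ?n)%R => let a := nc_quote K x in constr:(@NcPow K a n)
  | _ (@Ordinal _ ?k _) => constr:(@NcGen K k)
  end.

Ltac nc_reduce :=
  cbv beta iota zeta delta [normalize expand scalemon mulpoly powpoly rcatmon
    rewrite_descent addpoly addmon eqword allzero uq_rule cat Nat.ltb Nat.leb
    Nat.eqb fst snd];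
  rewrite /cadd /cmul /copp /cone.

(** Reduces an identity in the algebra to one equation in [K] for each word of the computed normal
    form. *)
Ltac nc rel :=
  apply/eqP; rewrite -subr_eq0; apply/eqP;
  lazymatch type of rel with
  | context [@UqG2_relations ?K] =>
    lazymatch goal with |- ?t = _ =>
      let e := nc_quote K t in
      refine (uq_nc_eq0 rel (fuel := 2000) (e := e) _)
    end
  end; nc_reduce.

(** * Maximal ideals and Ore elements *)

Section IdealTheory.
Variable R : nzRingType.
Implicit Types (I J M : set R).

Lemma idealN I x : two_sided_ideal I -> I x -> I (- x).
Proof. by move=> [_ _ Il _] Ix; rewrite -mulN1r; apply: Il. Qed.

Lemma idealB I x y : two_sided_ideal I -> I x -> I y -> I (x - y).
Proof. by move=> II Ix Iy; have [_ ID _ _] := II; apply: ID => //; apply: idealN. Qed.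

Lemma ideal_subl I x y : two_sided_ideal I -> I (x - y) -> I x -> I y.
Proof. by move=> II Ixy Ix; rewrite -(subKr x y); apply: idealB. Qed.

Lemma ideal1 I : two_sided_ideal I -> I 1 -> I = setT.
Proof.
by move=> [_ _ Il _] I1; apply/seteqP; split=> // x _; rewrite -(mulr1 x); apply: Il.
Qed.

Lemma ideal_proper I : two_sided_ideal I -> I <> setT -> ~ I 1.
Proof. by move=> II IT /(ideal1 II). Qed.

Definition ideal_sum I J : set R := [set x | exists y z, [/\ I y, J z & x = y + z]].

Lemma ideal_sumP I J : two_sided_ideal I -> two_sided_ideal J ->
  two_sided_ideal (ideal_sum I J).
Proof.
move=> [I0 ID Il Ir] [J0 JD Jl Jr]; split.
- by exists 0, 0; rewrite addr0.
- move=> _ _ [y [z [Iy Jz ->]]] [y' [z' [Iy' Jz' ->]]].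
  by exists (y + y'), (z + z'); rewrite addrACA; split; [apply: ID|apply: JD|].
- move=> a _ [y [z [Iy Jz ->]]]; exists (a * y), (a * z).
  by rewrite mulrDr; split; [apply: Il|apply: Jl|].
- move=> a _ [y [z [Iy Jz ->]]]; exists (y * a), (z * a).
  by rewrite mulrDl; split; [apply: Ir|apply: Jr|].
Qed.

Lemma maximal_add1 M J : maximal_two_sided_ideal M -> two_sided_ideal J ->
  ~ (J `<=` M)%classic -> exists m j, [/\ M m, J j & 1 = m + j].
Proof.
move=> [MI _ Mmax] JI JM; have [M0 _ _ _] := MI; have [J0 _ _ _] := JI.
have MS : (M `<=` ideal_sum M J)%classic by move=> m Mm; exists m, 0; rewrite addr0.
have [E|E] := Mmax _ (ideal_sumP MI JI) MS; last first.
  by have [m [j ?]] : ideal_sum M J 1 by [rewrite E|]; exists m, j.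
by case: JM => j Jj; rewrite -E; exists 0, j; rewrite add0r.
Qed.

(** If [J1] is not inside [M], then [1 = m + j] with [m] in [M] and [j] in [J1], and [y = m y + j y]
    lies in [M] for every [y] in [J2]. *)
Lemma maximal_prime M : maximal_two_sided_ideal M -> prime_two_sided_ideal M.
Proof.
move=> Mmax; have [MI MT _] := Mmax; have [_ MD _ Mr] := MI.
split=> // J1 J2 J1I J2I J12.
have [|J1M] := pselect (J1 `<=` M)%classic; [by left|right=> y Jy].
have [m [j [Mm Jj E]]] := maximal_add1 Mmax J1I J1M.
by rewrite -(mul1r y) E mulrDl; apply: MD; [apply: Mr|apply: J12].
Qed.

Lemma exists_maximal I : two_sided_ideal I -> ~ I 1 ->
  exists2 M, maximal_two_sided_ideal M & (I `<=` M)%classic.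
Proof.
move=> II I1; have [I0 ID Il Ir] := II.
(* Adjoining [I] inside the predicate lets the empty chain pass: its union is empty, and [I] itself
   is then the required ideal. *)
pose ok J := two_sided_ideal (I `|` J)%classic /\ ~ (I `|` J)%classic 1.
have [F okF totF|M [[MI M1] Mmax]] := @Zorn_bigcup _ ok.
  have IF x : (I `|` \bigcup_(X in F) X)%classic x <->
      I x \/ exists2 X, F X & (I `|` X)%classic x.
    split=> [[|[X FX Xx]]|[|[X FX [|Xx]]]]; [by left| |by left|by left|].
    - by right; exists X => //; right.
    - by right; exists X.
  split; last by move/IF=> [//|[X /okF[_ +] X1]]; apply.
  split.
  - by left.
  - have step x y X : I x -> F X -> (I `|` X)%classic y ->
        (I `|` \bigcup_(X in F) X)%classic (x + y).
      move=> Ix FX Xy; apply/IF; right; exists X => //.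
      by have [[_ D _ _] _] := okF _ FX; apply: D => //; left.
    move=> x y /IF[Ix|[X FX Xx]] /IF[Iy|[Y FY Yy]].
    + by left; apply: ID.
    + exact: step Yy.
    + by rewrite addrC; exact: step Xx.
    + have [XY|YX] := totF _ _ FX FY; apply/IF; right.
      * exists Y => //; have [[_ D _ _] _] := okF _ FY; apply: D => //.
        by case: Xx => [|/XY]; [left|right].
      * exists X => //; have [[_ D _ _] _] := okF _ FX; apply: D => //.
        by case: Yy => [|/YX]; [left|right].
  - move=> a x /IF[Ix|[X FX Xx]]; first by left; apply: Il.
    by apply/IF; right; exists X => //; have [[_ _ L _] _] := okF _ FX; apply: L.
  - move=> a x /IF[Ix|[X FX Xx]]; first by left; apply: Ir.
    by apply/IF; right; exists X => //; have [[_ _ _ L] _] := okF _ FX; apply: L.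
exists (I `|` M)%classic; last by move=> x; left.
split=> // [E|J JI MJ]; first by apply: M1; rewrite E.
have [J1|J1] := pselect (J 1); [by right; apply: ideal1|left].
apply/seteqP; split=> // x Jx; right; apply: contrapT => Mx.
apply: (Mmax J).
  split=> [|JM]; first by move=> y My; apply: MJ; right.
  by apply/Mx/JM.
have E : (I `|` J = J)%classic.
  by apply/seteqP; split=> [y [Iy|]|y] //; [apply: MJ; left|right].
by rewrite /ok E.
Qed.

(** The left Ore condition for the powers of [x], tested on one element. Leaving [N] arbitrary makes
    it stable under products. *)
Definition ore_mul (x b : R) := forall N, exists n b', x ^+ n * b = b' * x ^+ N.

(** The elements sent into [M] by left multiplication by some power of [x] form a two-sided ideal,
    by the Ore condition. It contains [M] but not [1], hence equals [M]. *)
Lemma maximal_regular M x : maximal_two_sided_ideal M ->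
    (forall b, ore_mul x b) -> (forall n, ~ M (x ^+ n)) ->
  forall c, M (x * c) -> M c.
Proof.
move=> [MI MT Mmax] xore xM c Mxc; have [M0 MD Ml Mr] := MI.
pose T : set R := [set c | exists n, M (x ^+ n * c)]%classic.
have TI : two_sided_ideal T.
  split.
  - by exists 0%N; rewrite mulr0.
  - move=> y z [n My] [m Mz]; exists (n + m)%N; rewrite mulrDr; apply: MD.
      by rewrite addnC exprD -mulrA; apply: Ml.
    by rewrite exprD -mulrA; apply: Ml.
  - move=> a y [n My]; have [m [a' E]] := xore a n; exists m.
    by rewrite mulrA E -mulrA; apply: Ml.
  - by move=> a y [n My]; exists n; rewrite mulrA; apply: Mr.
have [|<-|TT] := Mmax T TI; [|by exists 1%N|].
  by move=> y My; exists 0%N; rewrite mul1r.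
have [n] : T 1 by rewrite TT.
by rewrite mulr1 => /xM.
Qed.

(* [Rx + Ry] is a two-sided ideal which annihilates [x^(n+1)] modulo [P] as soon
   as [x^(n+2)] is in [P]; primeness then lowers the exponent. *)
Lemma prime_pow_descent (P : set R) (x y : R) : prime_two_sided_ideal P ->
    (forall b, exists c c', x * b = c * x + c' * y) ->
    (forall b, exists c c', y * b = c * x + c' * y) ->
    (forall n, P (x ^+ n.+1) -> P (y * x ^+ n)) ->
  forall n, P (x ^+ n) -> P x.
Proof.
move=> [PI PT Pprime] xb yb yx; have [P0 PD Pl Pr] := PI.
have kill n : P (x ^+ n.+2) -> P (x ^+ n.+1).
  move=> Px2; have Pyx := yx _ Px2.
  pose J1 : set R := [set z | exists c c', z = c * x + c' * y]%classic.
  pose J2 : set R := [set z | forall j, J1 j -> P (j * z)]%classic.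
  have J1r a z : J1 z -> J1 (z * a).
    move=> [c [c' ->]]; have [d [d' Ed]] := xb a; have [e [e' Ee]] := yb a.
    exists (c * d + c' * e), (c * d' + c' * e').
    by rewrite mulrDl -!mulrA Ed Ee !mulrDr !mulrDl !mulrA addrACA.
  have J1I : two_sided_ideal J1.
    split=> //.
    - by exists 0, 0; rewrite !mul0r addr0.
    - move=> _ _ [c [c' ->]] [e [e' ->]]; exists (c + e), (c' + e').
      by rewrite !mulrDl addrACA.
    - by move=> a _ [c [c' ->]]; exists (a * c), (a * c'); rewrite mulrDr !mulrA.
  have J2I : two_sided_ideal J2.
    split.
    - by move=> j _; rewrite mulr0.
    - by move=> u v Ju Jv j Jj; rewrite mulrDr; apply: PD; [apply: Ju|apply: Jv].
    - by move=> a u Ju j Jj; rewrite mulrA; apply/Ju/J1r.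
    - by move=> a u Ju j Jj; rewrite mulrA; apply/Pr/Ju.
  have [|J1P|J2P] := Pprime J1 J2 J1I J2I; first by move=> u v Ju; apply.
    by rewrite exprSr; apply/Pl/J1P; exists 1, 0; rewrite mul1r mul0r addr0.
  apply: J2P => _ [c [c' ->]]; rewrite mulrDl -!mulrA -exprS.
  by apply: PD; apply: Pl.
elim=> [P1|[|n] IHn]; [by rewrite -(mulr1 x); apply: Pl|by rewrite expr1|].
by move/kill.
Qed.

End IdealTheory.

(** * Ore elements and skew commutators in algebras *)

Section OreAlgebra.
Variables (K : fieldType) (B : algType K).
Implicit Types x b : B.

Lemma ore_mulD x b c : ore_mul x b -> ore_mul x c -> ore_mul x (b + c).
Proof.
move=> xb xc N; have [n [b' Eb]] := xb N; have [m [c' Ec]] := xc N.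
exists (m + n)%N, (x ^+ m * b' + x ^+ n * c'); rewrite mulrDr mulrDl.
by rewrite {1}exprD addnC exprD -!mulrA Eb Ec.
Qed.

Lemma ore_mulM x b c : ore_mul x b -> ore_mul x c -> ore_mul x (b * c).
Proof.
move=> xb xc N; have [m [c' Ec]] := xc N; have [n [b' Eb]] := xb m.
by exists n, (b' * c'); rewrite mulrA Eb -mulrA Ec mulrA.
Qed.

Lemma ore_mulZ x (c : K) b : ore_mul x b -> ore_mul x (c *: b).
Proof.
move=> xb N; have [n [b' Eb]] := xb N; exists n, (c *: b').
by rewrite -scalerAr Eb scalerAl.
Qed.

Lemma ore_mul1 x : ore_mul x 1.
Proof. by move=> N; exists N, 1; rewrite mulr1 mul1r. Qed.

(** Take [m] with [x^m b1] a left multiple of [x^N]. Each passage of a further [x] across [b] leaves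
    an error that is again a left multiple of [x^N], and after [N] passages the main term is one as
    well. *)
Lemma ore_mul_comm x b b1 (l : K) :
  x * b = l *: (b * x) + b1 -> ore_mul x b1 -> ore_mul x b.
Proof.
move=> E xb1 N; have [m [b1' E1]] := xb1 N.
have claim k : exists c, x ^+ (m + k) * b = l ^+ k *: (x ^+ m * b * x ^+ k) + c * x ^+ N.
  elim: k => [|k [c IHk]].
    by exists 0; rewrite addn0 mulr1 scale1r mul0r addr0.
  exists (l *: (c * x) + x ^+ k * b1').
  have -> : x ^+ (m + k.+1) * b = l *: (x ^+ (m + k) * b * x) + x ^+ k * (x ^+ m * b1).
    by rewrite addnS exprSr -mulrA E mulrDr -scalerAr !mulrA -exprD [(k + m)%N]addnC.
  rewrite IHk E1 mulrDl -scalerAl scalerDr scalerA -exprS -[_ * x ^+ k * x]mulrA -exprSr.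
  rewrite -addrA mulrDl -scalerAl !mulrA; congr (_ + (_ *: _ + _)).
  by rewrite -!mulrA -exprS -exprSr.
have [c Ec] := claim N; exists (m + N)%N, (l ^+ N *: (x ^+ m * b) + c).
by rewrite Ec mulrDl scalerAl.
Qed.

Lemma ore_mul_qcomm x b (l : K) : x * b = l *: (b * x) -> ore_mul x b.
Proof.
move=> E; apply: (@ore_mul_comm _ _ 0 l); first by rewrite addr0.
by rewrite -(scale0r (1 : B)); apply/ore_mulZ/ore_mul1.
Qed.

Lemma qcommX x b (l : K) n : x * b = l *: (b * x) -> x * b ^+ n = l ^+ n *: (b ^+ n * x).
Proof.
move=> E; elim: n => [|n IHn]; first by rewrite mulr1 mul1r scale1r.
by rewrite !exprSr mulrA IHn -scalerAl -[_ * x * b]mulrA E -scalerAr scalerA !mulrA.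
Qed.

Lemma qcomm_sym x b (l : K) : l != 0 -> x * b = l *: (b * x) -> b * x = l^-1 *: (x * b).
Proof. by move=> l0 ->; rewrite scalerA mulVf // scale1r. Qed.

(** The q-analogue of the rule for differentiating a power: [v] appears once in each position, and
    position [i] is weighted by [(l k)^i] when [v] is moved to the front. *)
Lemma qskew_expr (z u v : B) (l k : K) n :
    z * u = l *: (u * z) + v -> u * v = k *: (v * u) ->
  z * u ^+ n.+1 = l ^+ n.+1 *: (u ^+ n.+1 * z)
                  + (\sum_(i < n.+1) (l * k) ^+ i) *: (v * u ^+ n).
Proof.
move=> Ezu Euv; elim: n => [|n IHn].
  by rewrite big_ord_recl big_ord0 addr0 expr0 scale1r mulr1 !expr1.
have Evu : u ^+ n.+1 * v = k ^+ n.+1 *: (v * u ^+ n.+1).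
  elim: (n.+1) => [|m IHm]; first by rewrite mul1r mulr1 scale1r.
  rewrite ![_ ^+ m.+1]exprS -mulrA IHm -scalerAr [u * (_ * _)]mulrA.
  by rewrite Euv -scalerAl scalerA -!mulrA [k ^+ m * k]mulrC.
rewrite [u ^+ n.+2]exprSr mulrA IHn mulrDl -!scalerAl -[_ * z * u]mulrA Ezu mulrDr.
rewrite -scalerAr [u ^+ n.+1 * (u * z)]mulrA -[u ^+ n.+1 * u]exprSr scalerDr scalerA.
rewrite -[l ^+ n.+1 * l]exprSr Evu scalerA -exprMn.
rewrite -[v * u ^+ n * u]mulrA -[u ^+ n * u]exprSr.
rewrite -addrA -scalerDl [in RHS]big_ord_recr /=.
by rewrite [in RHS]addrC addrC [(l * k) ^+ _ + _]addrC.
Qed.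

Lemma geometric_neq0 (r : K) n : r ^+ n != 1 -> \sum_(i < n) r ^+ i != 0.
Proof. by apply: contra_neq => E; apply/subr0_eq; rewrite subrX1 E mulr0. Qed.

Section QSkew.
Variable P : set B.
Hypothesis PI : two_sided_ideal P.

Lemma idealZ (c : K) x : P x -> P (c *: x).
Proof. by have [_ _ Pl _] := PI; move=> Px; rewrite -mulr_algl; apply: Pl. Qed.

Lemma idealZ_inv (c : K) x : c != 0 -> P (c *: x) -> P x.
Proof. by move=> c0 /(idealZ c^-1); rewrite scalerA mulVf // scale1r. Qed.

(** Since [w] q-commutes with [z], the element [w (z u^(n+1) - l^(n+1) u^(n+1) z)] lies in [P]. By
    [qskew_expr] it is [w v u^n] times a geometric sum, which is nonzero because [(l k)^(n+1)] is
    not [1]. *)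
Lemma qskew_ideal (z u v w : B) (l k : K) n :
    z * u = l *: (u * z) + v -> u * v = k *: (v * u) -> (l * k) ^+ n.+1 != 1 ->
    (exists2 m : K, m != 0 & z * w = m *: (w * z)) ->
  P (w * u ^+ n.+1) -> P (w * v * u ^+ n).
Proof.
move=> Ezu Euv lk [m m0 Ezw] Pwu; have [_ _ Pl Pr] := PI.
apply: (idealZ_inv (geometric_neq0 lk)); rewrite -mulrA scalerAr.
have -> : (\sum_(i < n.+1) (l * k) ^+ i) *: (v * u ^+ n) =
    z * u ^+ n.+1 - l ^+ n.+1 *: (u ^+ n.+1 * z).
  by rewrite (qskew_expr n Ezu Euv) addrAC subrr add0r.
rewrite mulrBr; apply: idealB => //.
  by rewrite mulrA (qcomm_sym m0 Ezw) -scalerAl -mulrA; apply/idealZ/Pl.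
by rewrite -scalerAr mulrA; apply/idealZ/Pr.
Qed.

(** Factors are exchanged one at a time: [qskew_ideal] with [w = v^i] turns [v^i u^(j+1)] into
    [v^(i+1) u^j]. *)
Lemma qskew_pow_mem (z u v : B) (l k m : K) n :
    z * u = l *: (u * z) + v -> u * v = k *: (v * u) ->
    (forall i, (l * k) ^+ i.+1 != 1) -> m != 0 -> z * v = m *: (v * z) ->
  P (u ^+ n) -> P (v ^+ n).
Proof.
move=> Ezu Euv lk m0 Ezv.
suff step i j : P (v ^+ i * u ^+ j) -> P (v ^+ (i + j)).
  by move=> Pu; apply: (step 0%N); rewrite mul1r.
elim: j i => [|j IHj] i; first by rewrite mulr1 addn0.
move=> Pvu; rewrite addnS -addSn; apply: IHj; rewrite exprSr.
apply: (qskew_ideal Ezu Euv (lk j)) => //.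
by exists (m ^+ i); [rewrite expf_neq0 | apply: qcommX].
Qed.

End QSkew.
End OreAlgebra.

(** * Noetherianity of algebras with ordered monomials *)

Section DicksonLex.

(** Induction on the number of coordinates. A finite list [l0] that settles the first [n]
    coordinates has its last coordinates bounded by some [M]; it handles the elements whose last
    coordinate is at least [M], and each of the [M] remaining slices is settled by the induction
    hypothesis. *)
Lemma dickson (T : eqType) n (S : T -> Prop) (c : T -> nat -> nat) :
  exists l : seq T, (forall s, s \in l -> S s) /\
    forall t, S t -> exists2 s, s \in l & forall k, (k < n)%N -> (c s k <= c t k)%N.
Proof.
elim: n S => [|n IHn] S.
  have [[t St]|noS] := pselect (exists t, S t); last first.
    by exists [::]; split=> // t St; case: noS; exists t.
  exists [:: t]; split=> [s|s _]; first by rewrite inE => /eqP->.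
  by exists t; rewrite ?inE.
have [l0 [l0S l0dom]] := IHn S.
have [M lM] : exists M, forall s, s \in l0 -> (c s n <= M)%N.
  elim: l0 {l0S l0dom} => [|s l [M IH]]; first by exists 0%N.
  exists (maxn (c s n) M) => t; rewrite inE => /orP[/eqP->|/IH tM].
    exact: leq_maxl.
  exact: leq_trans tM (leq_maxr _ _).
suff [l [lS ldom]] : exists l : seq T, (forall s, s \in l -> S s) /\
    forall t, S t -> (c t n < M)%N ->
    exists2 s, s \in l & forall k, (k < n.+1)%N -> (c s k <= c t k)%N.
  exists (l0 ++ l); split=> [s|t St]; first by rewrite mem_cat => /orP[/l0S|/lS].
  have [tM|Mt] := ltnP (c t n) M.
    by have [s sl st] := ldom t St tM; exists s; rewrite ?mem_cat ?sl ?orbT.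
  have [s sl st] := l0dom t St; exists s; first by rewrite mem_cat sl.
  move=> k; rewrite ltnS leq_eqVlt => /orP[/eqP->|/st//].
  exact: leq_trans (lM s sl) Mt.
elim: M {lM} => [|M [l [lS ldom]]]; first by exists [::].
have [l' [l'S l'dom]] := IHn (fun t => S t /\ c t n = M).
exists (l ++ l'); split=> [s|t St].
  by rewrite mem_cat => /orP[/lS|/l'S[]].
rewrite ltnS leq_eqVlt => /orP[/eqP tM|tM].
  have [s sl st] := l'dom t (conj St tM); exists s; first by rewrite mem_cat sl orbT.
  move=> k; rewrite ltnS leq_eqVlt => /orP[/eqP->|/st//].
  by rewrite tM; have [_ ->] := l'S s sl.
by have [s sl st] := ldom t St tM; exists s; rewrite ?mem_cat ?sl.
Qed.

Definition lexlt n (f g : nat -> nat) := exists i,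
  [/\ (i < n)%N, (f i < g i)%N & forall j, (j < i)%N -> f j = g j].

(** Induction on the value at [0] and, within a fixed bound on it, on the tail [k |-> f (k+1)]. *)
Lemma lexlt_wf n : well_founded (lexlt n).
Proof.
elim: n => [|n IHn] f; first by constructor=> g [i []].
have [m] := ubnP (f 0%N); elim: m f => [f|m IHm f]; first by rewrite ltn0.
rewrite ltnS => fm; move: {-1}(fun k => f k.+1) (erefl (fun k => f k.+1)) => f'.
elim/(well_founded_ind IHn): f' f fm => f' IH f fm Ef.
constructor=> g [[|i] [i_n gf E]].
  apply: IHm; exact: leq_trans gf fm.
apply: (IH (fun k => g k.+1)); last reflexivity.
  by rewrite -Ef; exists i; split=> // j ji; rewrite E.
by rewrite (E 0%N).
Qed.

Lemma lexlt_trans n f g k : lexlt n f g -> lexlt n g k -> lexlt n f k.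
Proof.
move=> [i [i_n fg Ei]] [j [j_n gk Ej]]; exists (minn i j).
split; first by rewrite (leq_ltn_trans (geq_minl _ _)).
  case: (ltngtP i j) => [ij|ji|E].
  - by rewrite -(Ej i ij).
  - by rewrite (Ei j ji).
  - by rewrite E in fg *; apply: ltn_trans gk.
by move=> l; rewrite ltn_min => /andP[li lj]; rewrite Ei // Ej.
Qed.

Lemma lexlt_total n f g : [\/ lexlt n f g, lexlt n g f |
  forall i, (i < n)%N -> f i = g i].
Proof.
elim: n => [|n IHn]; first by constructor 3.
have widen a b : lexlt n a b -> lexlt n.+1 a b.
  by move=> [i [i_n ab E]]; exists i; rewrite (ltn_trans i_n).
case: IHn => [/widen|/widen|E]; [by constructor 1|by constructor 2|].
case: (ltngtP (f n) (g n)) => [lt|lt|eq].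
- by constructor 1; exists n; split.
- by constructor 2; exists n; split=> // j /E.
- by constructor 3 => i; rewrite ltnS leq_eqVlt => /orP[/eqP->|/E].
Qed.

End DicksonLex.

(** * Leading terms and right noetherianity *)

Section Noetherian.
Variables (K : fieldType) (B : algType K) (N : nat) (E : 'I_N -> B).
Local Notation word := (seq 'I_N).

Definition mon (w : word) : B := \prod_(i <- w) E i.

Inductive span (S : word -> Prop) : B -> Prop :=
  | span0 : span S 0
  | spanD c v x of S v & span S x : span S (c *: mon v + x).

Definition expo (w : word) (k : nat) : nat := count (fun i : 'I_N => k == i) w.
(** Only the multiplicities of letters are compared, so rearranging a word does not change its
    rank. *)
Definition wlt u v := lexlt N (expo u) (expo v).

(* The tails of the straightening relations only involve letters strictly
   between the two exchanged ones, so they are lexicographically smaller. *)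
Hypothesis straighten : forall i j : 'I_N, exists2 c : K, c != 0 &
  span (fun w => wlt w [:: i; j]) (E i * E j - c *: (E j * E i)).

Lemma mon_cat u v : mon (u ++ v) = mon u * mon v.
Proof. exact: big_cat. Qed.

Lemma span_add S x y : span S x -> span S y -> span S (x + y).
Proof.
elim=> [|c v z Sv _ IH] Sy; first by rewrite add0r.
by rewrite -addrA; constructor=> //; apply: IH.
Qed.

Lemma span_scale S (c : K) x : span S x -> span S (c *: x).
Proof.
elim=> [|d v z Sv _ IH]; first by rewrite scaler0; constructor.
by rewrite scalerDr scalerA; constructor.
Qed.

Lemma span_sub S x y : span S x -> span S y -> span S (x - y).
Proof. by move=> Sx Sy; rewrite -scaleN1r; apply: span_add => //; apply: span_scale. Qed.

Lemma span_mon (S : word -> Prop) v : S v -> span S (mon v).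
Proof. by move=> Sv; rewrite -[mon v]scale1r -[_ *: _]addr0; do 2?constructor. Qed.

Lemma span_mull (S S' : word -> Prop) u x :
  (forall v, S v -> S' (u ++ v)) -> span S x -> span S' (mon u * x).
Proof.
move=> SS'; elim=> [|c v z Sv _ IH]; first by rewrite mulr0; constructor.
by rewrite mulrDr -scalerAr -mon_cat; constructor=> //; apply: SS'.
Qed.

Lemma span_mulr (S S' : word -> Prop) u x :
  (forall v, S v -> S' (v ++ u)) -> span S x -> span S' (x * mon u).
Proof.
move=> SS'; elim=> [|c v z Sv _ IH]; first by rewrite mul0r; constructor.
by rewrite mulrDl -scalerAl -mon_cat; constructor=> //; apply: SS'.
Qed.

Lemma span_mono (S S' : word -> Prop) x :
  (forall v, S v -> S' v) -> span S x -> span S' x.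
Proof. by move=> SS'; elim=> *; constructor=> //; apply: SS'. Qed.

Lemma expo_cat u v k : expo (u ++ v) k = (expo u k + expo v k)%N.
Proof. exact: count_cat. Qed.

Lemma wlt_catl u v w : wlt v w -> wlt (u ++ v) (u ++ w).
Proof.
move=> [i [iN vw Ei]]; exists i; split=> // [|j /Ei Ej].
  by rewrite !expo_cat ltn_add2l.
by rewrite !expo_cat Ej.
Qed.

Lemma wlt_catr u v w : wlt v w -> wlt (v ++ u) (w ++ u).
Proof.
move=> [i [iN vw Ei]]; exists i; split=> // [|j /Ei Ej].
  by rewrite !expo_cat ltn_add2r.
by rewrite !expo_cat Ej.
Qed.

Lemma perm_expo u v : perm_eq u v -> expo u =1 expo v.
Proof. by move=> /permP E' k; apply: E'. Qed.

Lemma expo_perm u v : (forall k, (k < N)%N -> expo u k = expo v k) -> perm_eq u v.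
Proof.
move=> E'; apply/allP=> i _ /=; have := E' i (ltn_ord i).
have cE w : expo w i = count_mem i w by apply: eq_count => j; rewrite eq_sym.
by rewrite !cE => ->.
Qed.

Definition below u := span (wlt^~ u).

Lemma below_eq u v x : expo u =1 expo v -> below u x -> below v x.
Proof.
move=> uv; apply: span_mono => w [i [iN wu Ei]].
by exists i; split=> // [|j /Ei ->]; rewrite -?uv.
Qed.

Lemma below_lt u v x : wlt u v -> below u x -> below v x.
Proof. by move=> uv; apply: span_mono => w wu; apply: lexlt_trans wu uv. Qed.

(** Exchanging two adjacent letters costs a nonzero scalar and smaller words, and concatenation
    respects the order; a permutation is reached by inserting the letters one after the other. *)
Lemma perm_below u v : perm_eq u v ->
  exists2 c : K, c != 0 & below u (mon u - c *: mon v).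
Proof.
have trans u1 u2 u3 : perm_eq u1 u2 ->
    (exists2 c : K, c != 0 & below u1 (mon u1 - c *: mon u2)) ->
    (exists2 c : K, c != 0 & below u2 (mon u2 - c *: mon u3)) ->
    exists2 c : K, c != 0 & below u1 (mon u1 - c *: mon u3).
  move=> p12 [c c0 B12] [d d0 B23]; exists (c * d); first by rewrite mulf_neq0.
  have -> : mon u1 - (c * d) *: mon u3 =
      (mon u1 - c *: mon u2) + c *: (mon u2 - d *: mon u3).
    by rewrite scalerBr scalerA addrA subrK.
  apply: span_add => //; apply: span_scale.
  by apply: below_eq B23; apply: perm_expo; rewrite perm_sym.
have cons i u1 u2 : (exists2 c : K, c != 0 & below u1 (mon u1 - c *: mon u2)) ->
    exists2 c : K, c != 0 & below (i :: u1) (mon (i :: u1) - c *: mon (i :: u2)).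
  move=> [c c0 B12]; exists c => //.
  rewrite -(cat1s i u1) -(cat1s i u2) !mon_cat scalerAr -mulrBr.
  by apply: span_mull B12 => w; apply: wlt_catl.
have refl u1 : exists2 c : K, c != 0 & below u1 (mon u1 - c *: mon u1).
  by exists 1; rewrite ?oner_neq0 // scale1r subrr; constructor.
have insert i u1 u2 : exists2 c : K, c != 0 &
    below (i :: u1 ++ u2) (mon (i :: u1 ++ u2) - c *: mon (u1 ++ i :: u2)).
  elim: u1 => [|j u1 IHu]; first exact: refl.
  apply: (trans _ (j :: i :: u1 ++ u2)); last exact: cons IHu.
    by apply/permP=> a /=; rewrite addnCA.
  have [c c0 Sc] := straighten i j; exists c => //.
  have mon2 a b : mon [:: a, b & u1 ++ u2] = E a * E b * mon (u1 ++ u2).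
    by rewrite /mon !big_cons mulrA.
  rewrite /= !mon2 scalerAl -mulrBl.
  by apply: span_mulr Sc => w /(@wlt_catr (u1 ++ u2)).
elim: u v => [|i u IHu] v.
  by rewrite perm_sym => /perm_nilP ->; apply: refl.
move=> puv; have iv : i \in v by rewrite -(perm_mem puv) mem_head.
case/splitPr: iv puv => v1 v2 puv.
have {}puv : perm_eq u (v1 ++ v2).
  by rewrite -(perm_cons i) (perm_trans puv) // -cat1s perm_catCA.
apply: (trans _ (i :: v1 ++ v2)); [by rewrite perm_cons| |exact: insert].
exact/cons/IHu.
Qed.

(** The coefficient [c] may be zero: when two leading words have the same letters, a cancellation is
    not excluded. *)
Lemma span_lead S x : span S x -> x = 0 \/
  exists2 u, S u & exists c, below u (x - c *: mon u).
Proof.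
elim=> [|c v z Sv _ IH]; first by left.
right; case: IH => [->|[u Su [d Bz]]].
  by exists v => //; exists c; rewrite addr0 subrr; constructor.
have [vu|uv|E'] := lexlt_total N (expo v) (expo u).
- exists u => //; exists d; rewrite -addrA; apply: span_add => //.
  exact/span_scale/span_mon.
- exists v => //; exists c; rewrite addrC addKr -(subrK (d *: mon u) z).
  apply: span_add; first exact: below_lt Bz.
  exact/span_scale/span_mon.
- have puv := expo_perm E'; have [e _ Be] := perm_below puv.
  exists u => //; exists (c * e + d).
  have -> : c *: mon v + z - (c * e + d) *: mon u =
      c *: (mon v - e *: mon u) + (z - d *: mon u).
    by rewrite scalerBr scalerA scalerDl opprD addrACA.
  apply: span_add => //; apply: span_scale; apply: below_eq Be.
  exact: perm_expo.
Qed.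

Hypothesis mon_span : forall x, span (fun=> True) x.

Definition right_ideal (J : B -> Prop) :=
  [/\ J 0, forall x y, J x -> J y -> J (x + y) & forall a x, J x -> J (x * a)].

(** A Groebner basis argument: Dickson's lemma selects finitely many elements of [P] whose leading
    exponents divide all others, and reduction by their right multiples terminates because the order
    is well founded. *)
Lemma right_noetherian P : right_ideal P -> exists l : seq B,
  (forall p, p \in l -> P p) /\
  forall J, right_ideal J -> (forall p, p \in l -> J p) -> forall x, P x -> J x.
Proof.
move=> [P0 PD Pr].
have [us [usP usdom]] := dickson N (fun u => exists2 p, P p & below u (p - mon u)) expo.
have /choice[f fP] : forall u, exists p, u \in us -> P p /\ below u (p - mon u).
  by move=> u; case: (boolP (u \in us)) => [/usP[p]|_]; [exists p|exists 0].
exists (map f us); split=> [p /mapP[u /fP[Pu _] ->] //|J [J0 JD Jr] Jf].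
suff key u x (c : K) : P x -> below u (x - c *: mon u) -> J x.
  by move=> x Px; have [->|[u _ [c]]] := span_lead (mon_span x); [|apply: key].
move: {-2}(expo u) (erefl (expo u)) => eu; elim/(well_founded_ind (@lexlt_wf N)): eu u x c.
move=> eu IH u x c Eu Px Bx; rewrite {}Eu {eu} in IH.
have Pscale (d : K) y : P y -> P (d *: y).
  by move=> Py; rewrite -[y]mulr1 scalerAr; apply: Pr.
have Jscale (d : K) y : J y -> J (d *: y).
  by move=> Jy; rewrite -[y]mulr1 scalerAr; apply: Jr.
have lower y : P y -> below u y -> J y.
  by move=> Py /span_lead[->//|[v vu [d]]]; apply: (IH _ vu v y d).
have [c0|c0] := eqVneq c 0; first by apply: lower => //; rewrite c0 scale0r subr0 in Bx.
have [|w wus wu] := usdom u.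
  exists (c^-1 *: x); first exact: Pscale.
  rewrite -[mon u]scale1r -(mulVf c0) -scalerA -scalerBr.
  exact: span_scale.
have [Pfw Bfw] := fP w wus.
(* The word [r] has the complementary exponents, so that [f w * mon r] has the leading exponents of
   [u]. *)
pose r := flatten [seq nseq (expo u i - expo w i)%N i | i : 'I_N <- enum 'I_N].
have puw : perm_eq u (w ++ r).
  apply: expo_perm => k kN; rewrite expo_cat.
  suff -> : expo r k = (expo u k - expo w k)%N by rewrite subnKC ?wu.
  rewrite /expo count_flatten -map_comp -/(expo u k) -/(expo w k) sumnE big_map.
  rewrite big_enum /= (bigD1 (Ordinal kN)) //= count_nseq eqxx mul1n.
  rewrite big1 ?addn0 // => i ik; rewrite count_nseq.
  have /negPf -> // : k != i by apply: contraNneq ik => ki; apply/eqP/val_inj.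
have [e e0 Be] := perm_below puw.
have Bfr : below u (f w * mon r - mon (w ++ r)).
  rewrite mon_cat -mulrBl; apply: (@below_eq (w ++ r)).
    by move=> k; apply/esym/perm_expo.
  by apply: span_mulr Bfw => v /(@wlt_catr r).
rewrite -(subrK ((c * e) *: (f w * mon r)) x).
have Jfw : J ((c * e) *: (f w * mon r)) by apply/Jscale/Jr/Jf/map_f.
apply: JD => //; apply: lower.
  by apply: PD => //; rewrite -scaleNr; apply/Pscale/Pr.
have -> : x - (c * e) *: (f w * mon r) = (x - c *: mon u)
    + (c *: (mon u - e *: mon (w ++ r)) - (c * e) *: (f w * mon r - mon (w ++ r))).
  by rewrite !scalerBr scalerA addrA subrKA opprB subrKA.
apply: span_add => //; apply: span_sub; exact: span_scale.
Qed.

End Noetherian.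

(** * Maximal ideals containing [Omega1 - alpha] and [Omega2 - beta] *)

Section QCommutation.
Variables (K : fieldType) (B : algType K).
Implicit Types (x y z : B) (l : K).

Definition qcomm l x y := x * y = l *: (y * x).

Lemma qcomm_mull l l' x y z : qcomm l x z -> qcomm l' y z -> qcomm (l * l') (x * y) z.
Proof.
move=> xz yz; rewrite /qcomm -[LHS]mulrA yz -scalerAr [x * (_ * _)]mulrA xz -scalerAl.
by rewrite scalerA [l' * l]mulrC mulrA.
Qed.

Lemma qcomm_expl l x z n : qcomm l x z -> qcomm (l ^+ n) (x ^+ n) z.
Proof.
move=> xz; elim: n => [|n IHn]; first by rewrite /qcomm mul1r mulr1 scale1r.
by rewrite !exprS; apply: qcomm_mull.
Qed.

Lemma qcomm_refl x : qcomm 1 x x.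
Proof. by rewrite /qcomm scale1r. Qed.

Lemma qcomm1 x y : x * y = y * x -> qcomm 1 x y.
Proof. by move=> xy; rewrite /qcomm scale1r. Qed.

Lemma qcommZr l (c : K) x y : qcomm l x y -> qcomm l x (c *: y).
Proof. by move=> xy; rewrite /qcomm -scalerAr xy -scalerAl !scalerA mulrC. Qed.

(** Right multiplication by [b] maps the left ideal [B x + B y] into itself; for all [b] together
    this makes that left ideal two-sided. *)
Definition pair_stable x y b :=
  (exists c c', x * b = c * x + c' * y) /\ (exists c c', y * b = c * x + c' * y).

Lemma pair_stable_D x y a b :
  pair_stable x y a -> pair_stable x y b -> pair_stable x y (a + b).
Proof.
move=> [[c [c' Ec]] [e [e' Ee]]] [[d [d' Ed]] [f [f' Ef]]]; split.
  by exists (c + d), (c' + d'); rewrite mulrDr Ec Ed !mulrDl addrACA.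
by exists (e + f), (e' + f'); rewrite mulrDr Ee Ef !mulrDl addrACA.
Qed.

Lemma pair_stable_Z x y (k : K) a : pair_stable x y a -> pair_stable x y (k *: a).
Proof.
move=> [[c [c' Ec]] [e [e' Ee]]]; split.
  by exists (k *: c), (k *: c'); rewrite -scalerAr Ec scalerDr !scalerAl.
by exists (k *: e), (k *: e'); rewrite -scalerAr Ee scalerDr !scalerAl.
Qed.

Lemma pair_stable_M x y a b :
  pair_stable x y a -> pair_stable x y b -> pair_stable x y (a * b).
Proof.
move=> [[c [c' Ec]] [e [e' Ee]]] [[d [d' Ed]] [f [f' Ef]]]; split.
  exists (c * d + c' * f), (c * d' + c' * f').
  by rewrite mulrA Ec mulrDl -!mulrA Ed Ef !mulrDr !mulrDl !mulrA addrACA.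
exists (e * d + e' * f), (e * d' + e' * f').
by rewrite mulrA Ee mulrDl -!mulrA Ed Ef !mulrDr !mulrDl !mulrA addrACA.
Qed.

Lemma pair_stable_1 x y : pair_stable x y 1.
Proof.
split; first by exists 1, 0; rewrite mulr1 mul1r mul0r addr0.
by exists 0, 1; rewrite mulr1 mul1r mul0r add0r.
Qed.

Definition proportional x y := exists2 l, l != 0 & x = l *: y.

Lemma proportional_trans y x z :
  proportional x y -> proportional y z -> proportional x z.
Proof.
move=> [l l0 ->] [l' l'0 ->]; exists (l * l'); first by rewrite mulf_neq0.
by rewrite scalerA.
Qed.

Lemma proportional_mull z x y : proportional x y -> proportional (z * x) (z * y).
Proof. by move=> [l l0 ->]; exists l; rewrite // scalerAr. Qed.

Lemma proportional_swap l x y z n m : l != 0 -> qcomm l x y ->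
  proportional (x ^+ n * (y ^+ m * z)) (y ^+ m * (x ^+ n * z)).
Proof.
move=> l0 xy; exists ((l ^+ n) ^+ m); first by rewrite !expf_neq0.
by rewrite mulrA (qcommX m (qcomm_expl n xy)) -scalerAl mulrA.
Qed.

End QCommutation.

Lemma ord6_ind (Q : 'I_6 -> Prop) :
  Q (@Ordinal 6 0 isT) -> Q (@Ordinal 6 1 isT) -> Q (@Ordinal 6 2 isT) ->
  Q (@Ordinal 6 3 isT) -> Q (@Ordinal 6 4 isT) -> Q (@Ordinal 6 5 isT) ->
  forall i, Q i.
Proof.
move=> Q0 Q1 Q2 Q3 Q4 Q5 [[|[|[|[|[|[|//]]]]]] lt_i6];
  by rewrite (bool_irrelevance lt_i6 isT).
Qed.

(** * Quantum minors and their commutation relations *)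

Section MaximalIdeals.
Variables (K : fieldType) (q : K).
Hypotheses (q_neq0 : q != 0).
Hypothesis q_nru : forall n : nat, (0 < n)%N -> q ^+ n != 1.
Variables (B : algType K) (E : 'I_6 -> B).
Hypothesis Erel : forall r, r \in UqG2_relations q E -> r.1 = r.2.

Hypothesis Egen : forall S : B -> Prop, S 1 ->
  (forall x y, S x -> S y -> S (x + y)) -> (forall x y, S x -> S y -> S (x * y)) ->
  (forall (c : K) x, S x -> S (c *: x)) -> (forall i, S (E i)) -> forall x, S x.

Local Notation E1 := (E (@Ordinal 6 0 isT)).
Local Notation E2 := (E (@Ordinal 6 1 isT)).
Local Notation E3 := (E (@Ordinal 6 2 isT)).
Local Notation E4 := (E (@Ordinal 6 3 isT)).
Local Notation E5 := (E (@Ordinal 6 4 isT)).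
Local Notation E6 := (E (@Ordinal 6 5 isT)).
Local Notation h := (q ^+ 4 + q ^+ 2 + 1).
Local Notation d := (q ^+ 2 - 1).

(* The quantum minors [F] = [3,5] and [G] = [2,4]: together with [E3] and [E4]
   they q-commute, and [F] (resp. [G]) q-commutes with every generator except
   [E1] (resp. [E6]); [commF] and [commG] are the ordered forms of the remaining
   commutators [[E1, F]] and [[E6, G]]. *)
Definition minorF : B := E3 * E5 - (h / d) *: E4.
Definition minorG : B := E2 * E4 - (q ^+ 9 * d / h ^+ 2) *: E3 ^+ 3.
Definition commF : B := (h / q ^+ 2) *: (E2 * E5) - q ^+ 4 *: E3 ^+ 2.
Definition commG : B :=
  - (q ^+ 3 * d ^+ 2 / h) *: (E2 * E5 ^+ 3)
  + (q ^+ 5 * d ^+ 2 / h) *: (E3 ^+ 2 * E5 ^+ 2)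
  - (q ^+ 3 * d) *: (E3 * E4 * E5) + q ^+ 6 *: E4 ^+ 2.

Lemma qint2_neq0 : d != 0.
Proof. by rewrite subr_eq0 q_nru. Qed.

Lemma qint6_neq0 : q ^+ 6 - 1 != 0.
Proof. by rewrite subr_eq0 q_nru. Qed.

Lemma qint3_neq0 : h != 0.
Proof.
apply: contra_neq qint6_neq0 => h0.
have -> : q ^+ 6 - 1 = d * h by ring.
by rewrite h0 mulr0.
Qed.

(** A syntactic variant of [qint2_neq0], meant for the side conditions of [field]. *)
Lemma qint2_opp_neq0 : 1 + -1 * q ^+ 2 != 0.
Proof. by rewrite mulN1r -opprB oppr_eq0 qint2_neq0. Qed.

Ltac nc_field :=
  rewrite /minorF /minorG /commF /commG; nc Erel; repeat split; field;
  rewrite ?q_neq0 ?qint2_neq0 ?qint3_neq0 ?qint6_neq0 ?qint2_opp_neq0 ?andbT //.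

Lemma minorF_E1 : minorF * E1 = E1 * minorF - commF. Proof. nc_field. Qed.
Lemma minorF_E2 : minorF * E2 = q ^- 3 *: (E2 * minorF). Proof. nc_field. Qed.
Lemma minorF_E3 : minorF * E3 = q^-1 *: (E3 * minorF). Proof. nc_field. Qed.
Lemma minorF_E4 : minorF * E4 = E4 * minorF. Proof. nc_field. Qed.
Lemma minorF_E5 : minorF * E5 = q *: (E5 * minorF). Proof. nc_field. Qed.
Lemma minorF_E6 : minorF * E6 = q ^+ 3 *: (E6 * minorF). Proof. nc_field. Qed.
Lemma minorF_commF : minorF * commF = q ^- 2 *: (commF * minorF).
Proof. nc_field. Qed.

Lemma minorG_E1 : minorG * E1 = q ^- 3 *: (E1 * minorG). Proof. nc_field. Qed.
Lemma minorG_E2 : minorG * E2 = q ^- 3 *: (E2 * minorG). Proof. nc_field. Qed.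
Lemma minorG_E3 : minorG * E3 = E3 * minorG. Proof. nc_field. Qed.
Lemma minorG_E4 : minorG * E4 = q ^+ 3 *: (E4 * minorG). Proof. nc_field. Qed.
Lemma minorG_E5 : minorG * E5 = q ^+ 3 *: (E5 * minorG). Proof. nc_field. Qed.
Lemma minorG_E6 : minorG * E6 = E6 * minorG - commG. Proof. nc_field. Qed.
Lemma minorG_commG : minorG * commG = q ^+ 6 *: (commG * minorG).
Proof. nc_field. Qed.
Lemma minorG_minorF : minorG * minorF = q ^+ 3 *: (minorF * minorG).
Proof. nc_field. Qed.

Lemma E3_E5 : E3 * E5 = q ^+ 3 *: (E5 * E3) - d *: minorF.
Proof. nc_field. Qed.
Lemma E5_E3 : E5 * E3 = q ^- 3 *: (E3 * E5) + (d / q ^+ 3) *: minorF.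
Proof. nc_field. Qed.

(** Together with the relations of [minorF], this and the next five show that the left ideal
    generated by [minorF] and [commF] is stable under right multiplication by the generators. *)
Lemma commF_E1 : commF * E1 = q ^- 2 *: (E1 * commF). Proof. nc_field. Qed.
Lemma commF_E2 : commF * E2 = E2 * commF. Proof. nc_field. Qed.
Lemma commF_E3 : commF * E3 = E3 * commF + (h * d / q ^+ 5) *: (E2 * minorF).
Proof. nc_field. Qed.
Lemma commF_E4 : commF * E4 = E4 * commF + (d ^+ 2 / q ^+ 2) *: (E3 ^+ 2 * minorF).
Proof. nc_field. Qed.
Lemma commF_E5 :
  commF * E5 = E5 * commF + (d * (q ^+ 2 + 1) / q ^+ 2) *: (E3 * minorF).
Proof. nc_field. Qed.
Lemma commF_E6 : commF * E6 = E6 * commF + (q * d) *: (E5 * minorF).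
Proof. nc_field. Qed.

(** The counterparts for the left ideal generated by [minorG] and [commG] begin here. *)
Lemma commG_E1 : commG * E1 = E1 * commG + (d * h) *: (E5 * minorG).
Proof. nc_field. Qed.
Lemma commG_E2 : commG * E2 = E2 * commG +
  ((q ^- 3 - q ^+ 3) *: ((q ^+ 4 + q ^+ 2 - 1) *: E4
     + (q ^+ 2 - q ^+ 4) *: (E3 * E5))) * minorG.
Proof. nc_field. Qed.
Lemma commG_E3 : commG * E3 = E3 * commG + (d ^+ 2 * h) *: (E5 ^+ 2 * minorG).
Proof. nc_field. Qed.
Lemma commG_E4_comm :
  commG * E4 = E4 * commG + (q ^+ 3 * d ^+ 3) *: (E5 ^+ 3 * minorG).
Proof. nc_field. Qed.
Lemma commG_E5 : commG * E5 = E5 * commG. Proof. nc_field. Qed.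
Lemma commG_E6 : commG * E6 = q ^+ 6 *: (E6 * commG). Proof. nc_field. Qed.

(** Brings [minorG] into every two-sided ideal that contains [commF], thus linking the two
    minors. *)
Lemma minorG_commF :
  minorG = (- q ^+ 5 / h ^+ 2) *: (commF * E3 - q ^+ 2 *: (E3 * commF)).
Proof. nc_field. Qed.

(** Brings [minorF ^+ 3] into every two-sided ideal that contains [minorG] and [commG]; solved for
    [commG], it gives a Laurent expansion of [commG]. *)
Lemma commG_E4 : commG * E4 = (- q ^+ 6 * d ^+ 3 / h ^+ 3) *: minorF ^+ 3
  - (d ^+ 2 / (q ^+ 6 * h)) *: (minorG * E5 ^+ 3).
Proof. nc_field. Qed.

(** Modulo [Omega1 - alpha] this makes [E1] a fraction with denominator [minorF]; [Omega2_minorG]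
    does the same for [E6] and [minorG]. *)
Lemma Omega1_minorF :
  Omega1_expr q E = E1 * minorF - (q ^+ 2 / d) *: commF.
Proof. rewrite /Omega1_expr /=. nc_field. Qed.

Lemma Omega2_minorG :
  Omega2_expr q E = minorG * E6 + (q ^+ 6 / (d * h)) *: commG.
Proof. rewrite /Omega2_expr /=. nc_field. Qed.

Lemma uq_mon_span x : span E (fun=> True) x.
Proof.
apply: Egen x => [|x y|x y||i].
- by rewrite -(big_nil 1 *%R xpredT E); exact: (@span_mon _ _ _ E (fun=> True) [::]).
- exact: span_add.
- move=> + Sy; elim=> [|c v z _ _ IH]; first by rewrite mul0r; constructor.
  rewrite mulrDl -scalerAl; apply: span_add => //; apply: span_scale.
  exact: span_mull Sy.
- by move=> c x; apply: span_scale.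
- by rewrite -[E i](big_seq1 *%R i E); exact: (@span_mon _ _ _ E (fun=> True) [:: i]).
Qed.

Lemma uq_rule_tail a b : (b < a < 6)%N -> exists c t, [/\ c != 0,
  uq_rule q a b = (c, [:: b; a]) :: t &
  all (fun p => all (fun k => b < k < a)%N p.2) t].
Proof.
case/andP; case: a => [|[|[|[|[|[|//]]]]]]; case: b => [|[|[|[|[|[|//]]]]]] // _ _;
  by do 2 eexists; (split; [|reflexivity|by []]);
  rewrite ?oner_eq0 ?invr_eq0 ?expf_eq0 ?(negPf q_neq0).
Qed.

Lemma letter_ord (i : 'I_6) : letter E i = E i.
Proof. by move: i; apply: ord6_ind. Qed.

Lemma uq_straighten (i j : 'I_6) : exists2 c : K, c != 0 &
  span E (fun w => wlt w [:: i; j]) (E i * E j - c *: (E j * E i)).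
Proof.
have key (a b : 'I_6) : (b < a)%N -> exists2 c : K, c != 0 &
    span E (fun w => wlt w [:: b; a]) (E a * E b - c *: (E b * E a)).
  move=> ba; have [|c [t [c0 Et tP]]] := @uq_rule_tail a b; first by rewrite ba ltn_ord.
  exists c => //; rewrite -!letter_ord (uq_ruleP Erel) Et polyval_cons.
  rewrite !wordval_cons {1}/wordval big_nil mulr1 addrAC subrr add0r.
  elim: t tP {Et} => [|[e w] t IHt] /=; first by rewrite polyval_nil; constructor.
  case/andP=> wP /IHt St; rewrite polyval_cons.
  have Ew : w = map val (map (@inord 5) w).
    rewrite -map_comp -[LHS]map_id; apply/eq_in_map => k kw /=.
    have /andP[_ ka] := allP wP k kw.
    by rewrite inordK // (ltn_trans ka) ?ltn_ord.
  have -> : wordval (letter E) w = mon E (map (@inord 5) w).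
    rewrite {1}Ew /wordval big_map /mon; apply: eq_bigr => k _.
    exact: letter_ord.
  constructor=> //; have e0 (k : nat) : (k <= b)%N -> expo (map (@inord 5) w) k = 0%N.
    move=> kb; apply/eqP; rewrite /expo eqn0Ngt -has_count -all_predC.
    apply/allP=> _ /mapP[l lw ->]; have /andP[bl la] := allP wP l lw.
    by rewrite /= inordK ?(ltn_trans la) // neq_ltn (leq_ltn_trans kb bl).
  (* The words are compared at the letter [b]: it occurs once in [[:: b; a]], while neither it nor a
     smaller letter occurs in the tail. *)
  exists b; split=> //; first by rewrite e0 // /expo /= eqxx.
  move=> k kb; rewrite e0 1?ltnW // /expo /=.
  by rewrite (ltn_eqF kb) (ltn_eqF (ltn_trans kb ba)).
have [ij|ji|/val_inj->] := ltngtP i j.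
(* For [i < j] the product is already ordered, and the relation for [E j * E i] is solved for it. *)
- have [c c0 Sc] := key j i ij; exists c^-1; first by rewrite invr_neq0.
  have -> : E i * E j - c^-1 *: (E j * E i) = - c^-1 *: (E j * E i - c *: (E i * E j)).
    by rewrite scalerBr scalerA mulNr mulVf // !scaleNr scale1r opprK addrC.
  exact: span_scale.
- have [c c0 Sc] := key i j ji; exists c => //.
  by apply: below_eq Sc; apply: perm_expo; apply/permP=> a /=; rewrite addnCA.
- by exists 1; rewrite ?oner_neq0 // scale1r subrr; constructor.
Qed.

Lemma qpow_neq1 i j : q ^+ i.+1 ^+ j.+1 != 1.
Proof. by rewrite -exprM q_nru // muln_gt0. Qed.

Lemma qpowV_neq1 i j : (q ^- i.+1) ^+ j.+1 != 1.
Proof. by rewrite exprVn invr_eq1 qpow_neq1. Qed.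

Lemma qpow_inj i j : q ^+ i = q ^+ j -> i = j.
Proof.
wlog ij : i j / (i <= j)%N.
  by move=> wl; case: (leqP i j) => [/wl|/ltnW /wl wl'] // /esym /wl'.
move=> qij; have : q ^+ i * q ^+ (j - i) = q ^+ i * 1 by rewrite -exprD subnKC // mulr1.
move/(mulfI (expf_neq0 i q_neq0))/eqP; case: (posnP (j - i)%N) => [ji0 _|ji].
  by apply/eqP; rewrite eqn_leq ij -subn_eq0 ji0.
by rewrite (negPf (q_nru ji)).
Qed.

Lemma uq_ind (S : B -> Prop) : S 1 ->
  (forall x y, S x -> S y -> S (x + y)) -> (forall x y, S x -> S y -> S (x * y)) ->
  (forall (c : K) x, S x -> S (c *: x)) ->
  S E1 -> S E2 -> S E3 -> S E4 -> S E5 -> S E6 -> forall x, S x.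
Proof. by move=> *; apply: Egen => //; apply: ord6_ind. Qed.

Lemma ore_ind x : ore_mul x E1 -> ore_mul x E2 -> ore_mul x E3 -> ore_mul x E4 ->
  ore_mul x E5 -> ore_mul x E6 -> forall b, ore_mul x b.
Proof.
move=> x1 x2 x3 x4 x5 x6; apply: uq_ind => //.
- exact: ore_mul1.
- by move=> b c; apply: ore_mulD.
- by move=> b c; apply: ore_mulM.
- by move=> c b; apply: ore_mulZ.
Qed.

Lemma qcomm_E3_F : qcomm q E3 minorF. Proof. rewrite /qcomm; nc_field. Qed.
Lemma qcomm_E3_E2 : qcomm (q ^- 3) E3 E2. Proof. rewrite /qcomm; nc_field. Qed.
Lemma qcomm_E3_E4 : qcomm (q ^+ 3) E3 E4. Proof. rewrite /qcomm; nc_field. Qed.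
Lemma qcomm_E3_G : qcomm 1 E3 minorG. Proof. rewrite /qcomm; nc_field. Qed.
Lemma qcomm_E4_E3 : qcomm (q ^- 3) E4 E3. Proof. rewrite /qcomm; nc_field. Qed.
Lemma qcomm_E4_E5 : qcomm (q ^+ 3) E4 E5. Proof. rewrite /qcomm; nc_field. Qed.
Lemma qcomm_E4_F : qcomm 1 E4 minorF. Proof. rewrite /qcomm; nc_field. Qed.
Lemma qcomm_E4_G : qcomm (q ^- 3) E4 minorG. Proof. rewrite /qcomm; nc_field. Qed.
Lemma qcomm_E5_F : qcomm q^-1 E5 minorF. Proof. rewrite /qcomm; nc_field. Qed.
Lemma qcomm_E6_E5 : qcomm (q ^- 3) E6 E5. Proof. rewrite /qcomm; nc_field. Qed.
Lemma qcomm_F_G : qcomm (q ^- 3) minorF minorG. Proof. rewrite /qcomm; nc_field. Qed.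

(** Each generator q-commutes with [E3] up to a multiple of an element for which the Ore condition
    is already known: [E2] for [E1], [minorF] for [E5], and [E5 * E5] for [E6]. *)
Lemma ore_E3 b : ore_mul E3 b.
Proof.
have o2 := ore_mul_qcomm qcomm_E3_E2.
have o5 : ore_mul E3 E5.
  apply: (@ore_mul_comm _ _ _ _ (- d *: minorF) (q ^+ 3)).
    by rewrite E3_E5 scaleNr.
  exact/ore_mulZ/(ore_mul_qcomm qcomm_E3_F).
apply: ore_ind => //.
- apply: (@ore_mul_comm _ _ _ _ (- (q + q^-1 + q ^- 3) *: E2) q^-1).
    nc_field.
  exact: ore_mulZ.
- exact: ore_mul_qcomm (qcomm_refl _).
- exact: ore_mul_qcomm qcomm_E3_E4.
- apply: (@ore_mul_comm _ _ _ _ (- (1 - q ^+ 2) *: (E5 * E5)) 1).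
    rewrite scale1r; nc_field.
  exact/ore_mulZ/ore_mulM.
Qed.

Lemma ore_E4 b : ore_mul E4 b.
Proof.
have o3 := ore_mul_qcomm qcomm_E4_E3.
have o5 := ore_mul_qcomm qcomm_E4_E5.
apply: ore_ind => //.
- apply: (@ore_mul_comm _ _ _ _ ((1 - q ^+ 2) *: (E3 * E3)) 1).
    rewrite scale1r; nc_field.
  exact/ore_mulZ/ore_mulM.
- apply: (@ore_mul_comm _ _ _ _ (- (d ^+ 2 / h) *: (E3 * (E3 * E3))) (q ^- 3)).
    nc_field.
  exact/ore_mulZ/ore_mulM/ore_mulM.
- exact: ore_mul_qcomm (qcomm_refl _).
- apply: (@ore_mul_comm _ _ _ _ ((q ^+ 3 * d ^+ 2 / h) *: (E5 * (E5 * E5))) (q ^+ 3)).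
    nc_field.
  exact/ore_mulZ/ore_mulM/ore_mulM.
Qed.

Lemma ore_minorF b : ore_mul minorF b.
Proof.
apply: ore_ind.
- apply: (@ore_mul_comm _ _ _ _ (- 1 *: commF) 1).
    by rewrite scaleN1r scale1r minorF_E1.
  exact/ore_mulZ/(ore_mul_qcomm minorF_commF).
- exact: ore_mul_qcomm minorF_E2.
- exact: ore_mul_qcomm minorF_E3.
- exact: ore_mul_qcomm (qcomm1 minorF_E4).
- exact: ore_mul_qcomm minorF_E5.
- exact: ore_mul_qcomm minorF_E6.
Qed.

Lemma ore_minorG b : ore_mul minorG b.
Proof.
apply: ore_ind.
- exact: ore_mul_qcomm minorG_E1.
- exact: ore_mul_qcomm minorG_E2.
- exact: ore_mul_qcomm (qcomm1 minorG_E3).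
- exact: ore_mul_qcomm minorG_E4.
- exact: ore_mul_qcomm minorG_E5.
- apply: (@ore_mul_comm _ _ _ _ (- 1 *: commG) 1).
    by rewrite scaleN1r scale1r minorG_E6.
  exact/ore_mulZ/(ore_mul_qcomm minorG_commG).
Qed.

Lemma pair_stable_ind x y : pair_stable x y E1 -> pair_stable x y E2 ->
  pair_stable x y E3 -> pair_stable x y E4 -> pair_stable x y E5 ->
  pair_stable x y E6 -> forall b, pair_stable x y b.
Proof.
move=> *; apply: uq_ind => //.
- exact: pair_stable_1.
- by move=> *; apply: pair_stable_D.
- by move=> *; apply: pair_stable_M.
- by move=> *; apply: pair_stable_Z.
Qed.

Lemma left_combl (x y z u : B) : z = u * x -> exists c c', z = c * x + c' * y.
Proof. by move->; exists u, 0; rewrite mul0r addr0. Qed.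

Lemma left_combr (x y z u : B) : z = u * y -> exists c c', z = c * x + c' * y.
Proof. by move->; exists 0, u; rewrite mul0r add0r. Qed.

Lemma left_comb2 (x y z u v : B) : z = v * y + u * x -> exists c c', z = c * x + c' * y.
Proof. by move->; exists u, v; rewrite addrC. Qed.

Lemma minorF_pair_stable b : pair_stable minorF commF b.
Proof.
apply: pair_stable_ind; split.
- by exists E1, (- 1); rewrite minorF_E1 mulN1r.
- by apply: left_combr; rewrite commF_E1 scalerAl.
- by apply: left_combl; rewrite minorF_E2 scalerAl.
- by apply: left_combr; rewrite commF_E2.
- by apply: left_combl; rewrite minorF_E3 scalerAl.
- by apply: left_comb2; rewrite commF_E3 scalerAl.
- by apply: left_combl; rewrite minorF_E4.
- by apply: left_comb2; rewrite commF_E4 scalerAl.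
- by apply: left_combl; rewrite minorF_E5 scalerAl.
- by apply: left_comb2; rewrite commF_E5 scalerAl.
- by apply: left_combl; rewrite minorF_E6 scalerAl.
- by apply: left_comb2; rewrite commF_E6 scalerAl.
Qed.

Lemma minorG_pair_stable b : pair_stable minorG commG b.
Proof.
apply: pair_stable_ind; split.
- by apply: left_combl; rewrite minorG_E1 scalerAl.
- by apply: left_comb2; rewrite commG_E1 scalerAl.
- by apply: left_combl; rewrite minorG_E2 scalerAl.
- by apply: left_comb2; rewrite commG_E2.
- by apply: left_combl; rewrite minorG_E3.
- by apply: left_comb2; rewrite commG_E3 scalerAl.
- by apply: left_combl; rewrite minorG_E4 scalerAl.
- by apply: left_comb2; rewrite commG_E4_comm scalerAl.
- by apply: left_combl; rewrite minorG_E5 scalerAl.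
- by apply: left_combr; rewrite commG_E5.
- by exists E6, (- 1); rewrite minorG_E6 mulN1r.
- by apply: left_combr; rewrite commG_E6 scalerAl.
Qed.

(** * Monomials in the seed [E3], [E4], [minorF], [minorG] *)

Local Notation seed := (nat * nat * nat * nat)%type.

Definition seedmon (m : seed) : B :=
  let: (i, j, k, l) := m in E3 ^+ i * (E4 ^+ j * (minorF ^+ k * minorG ^+ l)).

Definition seed_add (m n : seed) : seed :=
  let: (i, j, k, l) := m in let: (i', j', k', l') := n in
  (i + i', j + j', k + k', l + l')%N.

Lemma seed_addC : commutative seed_add.
Proof.
move=> [[[i j] k] l] [[[i' j'] k'] l']; rewrite /seed_add.
by rewrite addnC (addnC j) (addnC k) (addnC l).
Qed.

Lemma seedmonM m n : proportional (seedmon m * seedmon n) (seedmon (seed_add m n)).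
Proof.
have qX k : q ^+ k != 0 by rewrite expf_neq0.
have qV k : q ^- k != 0 by rewrite invr_neq0.
case: m n => [[[i j] k] l] [[[i' j'] k'] l']; rewrite /= -!mulrA !exprD -!mulrA.
apply: proportional_mull.
(* The powers in the left monomial are moved into place from the inside out: first [minorG ^+ l],
   then [minorF ^+ k], then [E4 ^+ j], each swap costing a power of [q]. *)
apply: (proportional_trans (y := E4 ^+ j * (minorF ^+ k *
  (E3 ^+ i' * (E4 ^+ j' * (minorF ^+ k' * (minorG ^+ l * minorG ^+ l'))))))).
  do 2!apply: proportional_mull.
  apply: (proportional_trans (proportional_swap _ _ _ (oner_neq0 _) (qcomm1 minorG_E3)));
    apply: proportional_mull.
  apply: (proportional_trans (proportional_swap _ _ _ (qX _) minorG_E4));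
    apply: proportional_mull.
  exact: proportional_swap (qX _) minorG_minorF.
apply: (proportional_trans (y := E4 ^+ j *
  (E3 ^+ i' * (E4 ^+ j' * (minorF ^+ k * (minorF ^+ k' * (minorG ^+ l * minorG ^+ l'))))))).
  apply: proportional_mull.
  apply: (proportional_trans (proportional_swap _ _ _ (invr_neq0 q_neq0) minorF_E3));
    apply: proportional_mull.
  exact: proportional_swap (oner_neq0 _) (qcomm1 minorF_E4).
exact: proportional_swap (qV _) qcomm_E4_E3.
Qed.

Lemma seedmon0 : seedmon (0, 0, 0, 0)%N = 1.
Proof. by rewrite /= !mulr1. Qed.

Definition seed_span p := exists l, p = lincomb seedmon l.

Lemma seed_span_ind (S : B -> Prop) : S 0 ->
  (forall (c : K) m p, S p -> S (c *: seedmon m + p)) ->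
  forall p, seed_span p -> S p.
Proof.
move=> S0 SD p [l ->]; elim: l => [|[c m] l IHl]; first by rewrite /lincomb big_nil.
by rewrite /lincomb big_cons; apply: SD.
Qed.

Lemma seed_spanD p r : seed_span p -> seed_span r -> seed_span (p + r).
Proof. by move=> [l ->] [l' ->]; exists (l ++ l'); rewrite /lincomb big_cat. Qed.

Lemma seed_span_mon m : seed_span (seedmon m).
Proof. by exists [:: (1, m)]; rewrite /lincomb big_seq1 scale1r. Qed.

Lemma seed_span0 : seed_span 0.
Proof. by exists [::]; rewrite /lincomb big_nil. Qed.

Lemma seed_spanZ (c : K) p : seed_span p -> seed_span (c *: p).
Proof.
move=> [l ->]; exists [seq (c * t.1, t.2) | t <- l].
by rewrite /lincomb big_map scaler_sumr; apply: eq_bigr => t _; rewrite scalerA.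
Qed.

Lemma seed_span_prop m x : proportional x (seedmon m) -> seed_span x.
Proof. by move=> [c _ ->]; apply/seed_spanZ/seed_span_mon. Qed.

Lemma seed_spanM p r : seed_span p -> seed_span r -> seed_span (p * r).
Proof.
move=> Qp Qr; move: p Qp; apply: seed_span_ind => [|c m p IHp].
  by rewrite mul0r; apply: seed_span0.
rewrite mulrDl -scalerAl; apply: seed_spanD => //; apply: seed_spanZ.
move: r Qr {IHp}; apply: seed_span_ind => [|e n r IHr].
  by rewrite mulr0; apply: seed_span0.
rewrite mulrDr -scalerAr; apply: seed_spanD => //; apply: seed_spanZ.
exact: seed_span_prop (seedmonM m n).
Qed.

Lemma seed_span_swap m p : seed_span p ->
  exists2 p', seed_span p' & seedmon m * p = p' * seedmon m.
Proof.
move: p; apply: seed_span_ind => [|c n p [p' Qp' E']].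
  by exists 0; [exact: seed_span0|rewrite mulr0 mul0r].
have [l l0 El] := seedmonM m n; have [l' l'0 El'] := seedmonM n m.
exists ((c * (l / l')) *: seedmon n + p').
  by apply: seed_spanD => //; apply/seed_spanZ/seed_span_mon.
rewrite mulrDr mulrDl E' -scalerAr -scalerAl El El' seed_addC !scalerA; congr (_ *: _ + _).
by rewrite -mulrA mulfVK.
Qed.

(** * Clearing denominators modulo [I] *)

Section Saturation.
Variables (alpha beta : K) (I : set B).
Hypothesis II : two_sided_ideal I.
Hypothesis IO1 : I (Omega1_expr q E - alpha%:A).
Hypothesis IO2 : I (Omega2_expr q E - beta%:A).

(** Expresses, without forming a localization, that [b] is modulo [I] a Laurent polynomial in the
    seed with denominator [m] on the left. *)
Definition clearable b := exists m p, seed_span p /\ I (seedmon m * b - p).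

Lemma clearable_span p : seed_span p -> clearable p.
Proof.
move=> Qp; exists (0, 0, 0, 0)%N, p; split=> //.
by rewrite seedmon0 mul1r subrr; have [] := II.
Qed.

Lemma clearable_congr b c : I (b - c) -> clearable c -> clearable b.
Proof.
move=> Ibc [m [p [Qp Ip]]]; exists m, p; split=> //; have [_ ID Il _] := II.
by rewrite -(subrK c b) mulrDr -addrA; apply: ID => //; apply: Il.
Qed.

Lemma clearable_div m b : clearable (seedmon m * b) -> clearable b.
Proof.
move=> [n [p [Qp Ip]]]; have [l l0 El] := seedmonM n m.
exists (seed_add n m), (l^-1 *: p); split; first exact: seed_spanZ.
apply: (idealZ_inv II l0); rewrite scalerBr scalerA mulfV // scale1r scalerAl -El -mulrA.
exact: Ip.
Qed.

Lemma clearableD b c : clearable b -> clearable c -> clearable (b + c).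
Proof.
move=> [m [p [Qp Ip]]] [n [r [Qr Ir]]]; have [_ ID Il _] := II.
have [l l0 El] := seedmonM m n; have [l' l'0 El'] := seedmonM n m.
exists (seed_add m n), (l'^-1 *: (seedmon n * p) + l^-1 *: (seedmon m * r)); split.
  by apply: seed_spanD; apply: seed_spanZ; apply: seed_spanM => //; apply: seed_span_mon.
rewrite mulrDr opprD addrACA; apply: ID.
  apply: (idealZ_inv II l'0); rewrite scalerBr scalerA mulfV // scale1r scalerAl.
  by rewrite seed_addC -El' -mulrA -mulrBr; apply: Il.
apply: (idealZ_inv II l0); rewrite scalerBr scalerA mulfV // scale1r scalerAl -El.
by rewrite -mulrA -mulrBr; apply: Il.
Qed.

Lemma clearableZ (c : K) b : clearable b -> clearable (c *: b).
Proof.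
move=> [m [p [Qp Ip]]]; exists m, (c *: p); split; first exact: seed_spanZ.
by rewrite -scalerAr -scalerBr; apply: idealZ.
Qed.

(** Modulo [I], the product [n m b c] is [n p c]; then [n] passes across [p] at the price of
    replacing [p] by [p'], and [n c] becomes [r]. *)
Lemma clearableM b c : clearable b -> clearable c -> clearable (b * c).
Proof.
move=> [m [p [Qp Ip]]] [n [r [Qr Ir]]]; have [_ ID Il Irr] := II.
have [p' Qp' E'] := seed_span_swap n Qp.
apply: (@clearable_div m); apply: (@clearable_div n).
apply: (@clearable_congr _ (p' * r)); last exact/clearable_span/seed_spanM.
have -> : seedmon n * (seedmon m * (b * c)) - p' * r =
    seedmon n * ((seedmon m * b - p) * c) + p' * (seedmon n * c - r).
  by rewrite mulrBl !mulrBr !mulrA E' addrA subrK.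
by apply: ID; apply: Il => //; apply: Irr.
Qed.

(** [E3 * E5] and [E4 * E2] are polynomials in the seed, which settles [E5] and [E2], hence [commF]
    and [commG]. Modulo [I], the products [minorF * E1] and [minorG * E6] are then a scalar plus a
    multiple of [commF] and of [commG]. *)
Lemma clearable_all b : clearable b.
Proof.
have C1 : clearable 1 by rewrite -seedmon0; apply/clearable_span/seed_span_mon.
have QF : seed_span minorF.
  by have := seed_span_mon (0, 0, 1, 0)%N; rewrite /= !mul1r mulr1.
have QG : seed_span minorG.
  by have := seed_span_mon (0, 0, 0, 1)%N; rewrite /= !mul1r.
have Q3 : seed_span E3.
  by have := seed_span_mon (1, 0, 0, 0)%N; rewrite /= !mulr1.
have Q4 : seed_span E4.
  by have := seed_span_mon (0, 1, 0, 0)%N; rewrite /= !mulr1 mul1r.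
have C3 := clearable_span Q3; have C4 := clearable_span Q4.
have C5 : clearable E5.
  apply: (@clearable_div (1, 0, 0, 0)%N); rewrite /= !mulr1.
  apply: clearable_span.
  have -> : E3 * E5 = minorF + (h / d) *: E4 by rewrite subrK.
  by apply: seed_spanD => //; apply: seed_spanZ.
have C2 : clearable E2.
  apply: (@clearable_div (0, 1, 0, 0)%N); rewrite /= !mulr1 mul1r.
  apply: clearable_span.
  have -> : E4 * E2 = q ^- 3 *: minorG
      + (q ^+ 6 * d / h ^+ 2 - d ^+ 2 / h) *: (E3 * (E3 * E3)).
    by nc_field.
  by apply: seed_spanD => //; apply: seed_spanZ => //; do 2?apply: seed_spanM.
have CX x n : clearable x -> clearable (x ^+ n).
  by move=> Cx; elim: n => // n IHn; rewrite exprS; apply: clearableM.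
have Cc : clearable commF.
  by apply: clearableD; [|rewrite -scaleNr]; apply: clearableZ;
    [apply: clearableM|apply: CX].
have Cg : clearable commG.
  apply: clearableD; last by apply/clearableZ/CX.
  apply: clearableD; first apply: clearableD.
  - by apply/clearableZ/clearableM/CX.
  - by apply/clearableZ/clearableM; apply: CX.
  - by rewrite -scaleNr; apply/clearableZ/clearableM => //; apply: clearableM.
move: b; apply: uq_ind => //.
- exact: clearableD.
- exact: clearableM.
- by move=> c x; apply: clearableZ.
- apply: (@clearable_div (0, 0, 1, 0)%N); rewrite /= !mul1r mulr1.
  apply: (@clearable_congr _ (alpha%:A + (q ^+ 2 / d - 1) *: commF)); last first.
    by apply: clearableD; apply: clearableZ.
  rewrite minorF_E1 scalerBl scale1r [- (_%:A + _)]opprD [- (_ - commF)]opprB.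
  rewrite addrACA addKr addrAC.
  by rewrite -Omega1_minorF.
- apply: (@clearable_div (0, 0, 0, 1)%N); rewrite /= !mul1r.
  apply: (@clearable_congr _ (beta%:A - (q ^+ 6 / (d * h)) *: commG)); last first.
    by apply: clearableD; [|rewrite -scaleNr]; apply: clearableZ.
  by rewrite opprB addrA -Omega2_minorG.
Qed.

End Saturation.

(** * Regularity and independence of the seed modulo a maximal ideal *)

Section Regular.
Variables (alpha beta : K) (M : set B).
Hypothesis ab_neq0 : (alpha, beta) != (0, 0).
Hypothesis Mmax : maximal_two_sided_ideal M.
Hypothesis MO1 : M (Omega1_expr q E - alpha%:A).
Hypothesis MO2 : M (Omega2_expr q E - beta%:A).

Let MI : two_sided_ideal M. Proof. by have [] := Mmax. Qed.

Let M1 : ~ M 1.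
Proof. by have [? ? _] := Mmax; apply: ideal_proper. Qed.

Lemma maximal_scalar0 (c : K) : M c%:A -> c = 0.
Proof. by move=> Mc; apply: contrapT => /eqP c0; apply/M1/(idealZ_inv MI c0). Qed.

(** Membership in [M] passes from [minorF] to [commF], then to [minorG] and [commG], hence to
    [Omega1] and [Omega2]; the scalars [alpha] and [beta] then lie in [M] and vanish, against
    [ab_neq0]. *)
Lemma minorF_notin : ~ M minorF.
Proof.
move=> MF; have [_ MD Ml Mr] := MI.
have Mc : M commF.
  have -> : commF = E1 * minorF - minorF * E1 by rewrite minorF_E1 opprB addrC subrK.
  by apply: idealB; [|apply: Ml|apply: Mr].
have MG : M minorG.
  rewrite minorG_commF; apply: (idealZ MI); apply: idealB; [|exact: Mr|] => //.
  exact/(idealZ MI)/Ml.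
have Mg : M commG.
  have -> : commG = E6 * minorG - minorG * E6 by rewrite minorG_E6 opprB addrC subrK.
  by apply: idealB; [|apply: Ml|apply: Mr].
have a0 : alpha = 0.
  apply: maximal_scalar0; apply: (ideal_subl MI MO1); rewrite Omega1_minorF.
  by apply: idealB; [|apply: Ml|apply: idealZ].
have b0 : beta = 0.
  apply: maximal_scalar0; apply: (ideal_subl MI MO2); rewrite Omega2_minorG.
  by apply: MD; [apply: Mr|apply: idealZ].
by move: ab_neq0; rewrite a0 b0 eqxx.
Qed.

Let Mprime : prime_two_sided_ideal M. Proof. exact: maximal_prime. Qed.

(** [prime_pow_descent] applies with [commF] as second element: commuting with [E1] replaces one
    factor [minorF] by [commF]. *)
Lemma minorF_pow_notin n : ~ M (minorF ^+ n).
Proof.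
move=> MFn; apply: minorF_notin.
apply: (prime_pow_descent (y := commF) Mprime _ _ _ MFn) => [b|b|{MFn}n MFn].
- by have [] := minorF_pair_stable b.
- by have [] := minorF_pair_stable b.
rewrite -(mul1r commF).
apply: (qskew_ideal MI (z := E1) (l := 1) _ minorF_commF); rewrite ?mul1r //.
- by rewrite scale1r minorF_E1 subrK.
- exact: qpowV_neq1.
- by exists 1; rewrite ?oner_neq0 // mulr1 scale1r.
Qed.

(** As for [minorF], a power of [minorG] in [M] forces [minorG] and then [commG] into [M];
    [commG_E4] then brings in the cube of [minorF]. *)
Lemma minorG_pow_notin n : ~ M (minorG ^+ n).
Proof.
move=> MGn; have [_ MD Ml Mr] := MI.
have MG : M minorG.
  apply: (prime_pow_descent (y := commG) Mprime _ _ _ MGn) => [b|b|{MGn}n MGn].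
  - by have [] := minorG_pair_stable b.
  - by have [] := minorG_pair_stable b.
  rewrite -(mul1r commG).
  apply: (qskew_ideal MI (z := E6) (l := 1) _ minorG_commG); rewrite ?mul1r //.
  - by rewrite scale1r minorG_E6 subrK.
  - exact: qpow_neq1.
  - by exists 1; rewrite ?oner_neq0 // mulr1 scale1r.
have Mg : M commG.
  have -> : commG = E6 * minorG - minorG * E6 by rewrite minorG_E6 opprB addrC subrK.
  by apply: idealB; [|apply: Ml|apply: Mr].
apply: (@minorF_pow_notin 3).
have c0 : - q ^+ 6 * d ^+ 3 / h ^+ 3 != 0.
  by rewrite !mulf_neq0 ?oppr_eq0 ?invr_neq0 ?expf_neq0 ?qint2_neq0 ?qint3_neq0.
apply: (idealZ_inv MI c0).
rewrite -[X in M X](subrK ((d ^+ 2 / (q ^+ 6 * h)) *: (minorG * E5 ^+ 3))) -commG_E4.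
by apply: MD; [apply: Mr|apply/(idealZ MI)/Mr].
Qed.

(** Skew commutation with [E5] turns each factor [E3] into a multiple of [minorF]. *)
Lemma E3_pow_notin n : ~ M (E3 ^+ n).
Proof.
move=> ME3; apply: (@minorF_pow_notin n).
have c0 : (d / q ^+ 3) ^+ n != 0.
  by rewrite expf_neq0 ?mulf_neq0 ?invr_neq0 ?expf_neq0 ?qint2_neq0.
apply: (idealZ_inv MI c0); rewrite -exprZn.
apply: (qskew_pow_mem MI (k := q) (m := q^-1) E5_E3) ME3.
- exact: qcommZr qcomm_E3_F.
- move=> i; suff -> : q ^- 3 * q = q ^- 2 by apply: qpowV_neq1.
  by field.
- by rewrite invr_neq0.
- exact: qcommZr qcomm_E5_F.
Qed.

(** [E5] is not a seed element; it is the intermediate step between [E4] and [minorF]. *)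
Lemma E5_pow_notin n : ~ M (E5 ^+ n).
Proof.
move=> ME5; apply: (@minorF_pow_notin n).
have c0 : (- d) ^+ n != 0 by rewrite expf_neq0 ?oppr_eq0 ?qint2_neq0.
apply: (idealZ_inv MI c0); rewrite -exprZn.
apply: (qskew_pow_mem MI (z := E3) (u := E5) (l := q ^+ 3) (k := q^-1) (m := q)) ME5 => //.
- by rewrite E3_E5 scaleNr.
- exact: qcommZr qcomm_E5_F.
- move=> i; suff -> : q ^+ 3 * q^-1 = q ^+ 2 by apply: qpow_neq1.
  by field.
- exact: qcommZr qcomm_E3_F.
Qed.

(** Skew commutation with [E6] turns each factor [E4] into a multiple of [E5 ^+ 3], whence the
    exponent [3 * n]. *)
Lemma E4_pow_notin n : ~ M (E4 ^+ n).
Proof.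
move=> ME4; apply: (@E5_pow_notin (3 * n)).
have c0 : (- (d ^+ 2 / h)) ^+ n != 0.
  by rewrite expf_neq0 ?oppr_eq0 ?mulf_neq0 ?invr_neq0 ?expf_neq0 ?qint2_neq0 ?qint3_neq0.
apply: (idealZ_inv MI c0); rewrite exprM -exprZn.
apply: (qskew_pow_mem MI (z := E6) (u := E4) (l := q ^- 3) (k := q ^+ 3 ^+ 3)
  (m := (q ^- 3) ^+ 3)) ME4.
- nc_field.
- apply: qcommZr; exact: qcommX qcomm_E4_E5.
- move=> i; suff -> : q ^- 3 * q ^+ 3 ^+ 3 = q ^+ 6 by apply: qpow_neq1.
  by field.
- by rewrite expf_neq0 ?invr_neq0 ?expf_neq0.
- apply: qcommZr; exact: qcommX qcomm_E6_E5.
Qed.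

Definition regular_mod x := forall c, M (x * c) -> M c.

Lemma E3_regular : regular_mod E3.
Proof. exact: maximal_regular Mmax ore_E3 E3_pow_notin. Qed.
Lemma E4_regular : regular_mod E4.
Proof. exact: maximal_regular Mmax ore_E4 E4_pow_notin. Qed.
Lemma minorF_regular : regular_mod minorF.
Proof. exact: maximal_regular Mmax ore_minorF minorF_pow_notin. Qed.
Lemma minorG_regular : regular_mod minorG.
Proof. exact: maximal_regular Mmax ore_minorG minorG_pow_notin. Qed.
Lemma seedmon_E3 i j k l : seedmon (i, j, k, l) * E3 =
  q ^- (3 * j + k) *: (E3 * seedmon (i, j, k, l)).
Proof.
have := qcomm_mull (qcomm_expl i (qcomm_refl E3)) (qcomm_mull (qcomm_expl j qcomm_E4_E3)
  (qcomm_mull (qcomm_expl k minorF_E3) (qcomm_expl l (qcomm1 minorG_E3)))).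
by rewrite !expr1n mul1r mulr1 !exprVn -exprM -invfM -exprD.
Qed.

Lemma seedmon_E4 i j k l : seedmon (i, j, k, l) * E4 =
  q ^+ (3 * i + 3 * l) *: (E4 * seedmon (i, j, k, l)).
Proof.
have := qcomm_mull (qcomm_expl i qcomm_E3_E4) (qcomm_mull (qcomm_expl j (qcomm_refl E4))
  (qcomm_mull (qcomm_expl k (qcomm1 minorF_E4)) (qcomm_expl l minorG_E4))).
by rewrite !expr1n !mul1r -!exprM -exprD.
Qed.

Lemma seedmon_minorF i j k l : seedmon (i, j, k, l) * minorF =
  q ^+ (i + 3 * l) *: (minorF * seedmon (i, j, k, l)).
Proof.
have := qcomm_mull (qcomm_expl i qcomm_E3_F) (qcomm_mull (qcomm_expl j qcomm_E4_F)
  (qcomm_mull (qcomm_expl k (qcomm_refl minorF)) (qcomm_expl l minorG_minorF))).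
by rewrite !expr1n !mul1r -!exprM -exprD.
Qed.

Lemma seedmon_minorG i j k l : seedmon (i, j, k, l) * minorG =
  q ^- (3 * j + 3 * k) *: (minorG * seedmon (i, j, k, l)).
Proof.
have := qcomm_mull (qcomm_expl i qcomm_E3_G) (qcomm_mull (qcomm_expl j qcomm_E4_G)
  (qcomm_mull (qcomm_expl k qcomm_F_G) (qcomm_expl l (qcomm_refl minorG)))).
by rewrite !expr1n mul1r mulr1 !exprVn -!exprM -invfM -exprD.
Qed.

(* Monomials in the seed have pairwise distinct systems of commutation scalars
   with the four seed elements, so they are linearly independent modulo [M]. *)
Lemma seedmon_indep (c : seed -> K) (s : seq seed) : uniq s ->
  M (\sum_(m <- s) c m *: seedmon m) -> forall m, m \in s -> c m = 0.
Proof.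
have notin m : ~ M (seedmon m).
  case: m => [[[i j] k] l] /=.
  have strip x y n : regular_mod x -> M (x ^+ n * y) -> M y.
    by move=> xr; elim: n => [|n IHn]; [rewrite mul1r|rewrite exprS -mulrA => /xr].
  move/(strip _ _ _ E3_regular)/(strip _ _ _ E4_regular)/(strip _ _ _ minorF_regular).
  by rewrite -[minorG ^+ l]mulr1 => /(strip _ _ _ minorG_regular).
have [_ MD Ml Mr] := MI.
elim: s c => [|n s IHs] c //= /andP[ns us] Mp.
(* The skew commutator of the sum with [x], formed with the scalar of [n], loses its term in [n];
   cancelling [x] leaves a shorter relation for the induction hypothesis. *)
have kill x (chi : seed -> K) : regular_mod x ->
    (forall m, seedmon m * x = chi m *: (x * seedmon m)) ->
    forall m, m \in s -> (chi m - chi n) * c m = 0.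
  move=> xr xchi; apply: IHs => //; apply: xr.
  have -> : x * (\sum_(m <- s) ((chi m - chi n) * c m) *: seedmon m) =
      (\sum_(m <- n :: s) c m *: seedmon m) * x
      - chi n *: (x * \sum_(m <- n :: s) c m *: seedmon m).
    rewrite !mulr_sumr mulr_suml scaler_sumr -sumrB big_cons.
    rewrite -scalerAl xchi -scalerAr !scalerA [c n * _]mulrC subrr add0r.
    apply: eq_bigr => m _; rewrite -!scalerAr -scalerAl xchi !scalerA -scalerBl.
    by rewrite mulrBl [c m * _]mulrC.
  by apply: idealB; [|apply: Mr|apply: idealZ => //; apply: Ml].
have cs m : m \in s -> c m = 0.
  move=> ms; apply: contraNeq ns => cm0.
  suff -> : n = m by [].
  have {}kill x (chi : seed -> K) : regular_mod x ->
      (forall m, seedmon m * x = chi m *: (x * seedmon m)) -> chi m = chi n.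
    move=> xr xchi; have /eqP := kill x chi xr xchi m ms.
    by rewrite mulf_eq0 (negPf cm0) orbF subr_eq0 => /eqP.
  have := kill E3 (fun m => let: (i, j, k, l) := m in q ^- (3 * j + k)) E3_regular.
  have := kill E4 (fun m => let: (i, j, k, l) := m in q ^+ (3 * i + 3 * l)) E4_regular.
  have := kill minorF (fun m => let: (i, j, k, l) := m in q ^+ (i + 3 * l)) minorF_regular.
  have := kill minorG (fun m => let: (i, j, k, l) := m in q ^- (3 * j + 3 * k))
    minorG_regular.
  case: m n {us Mp kill ms cm0} => [[[i j] k] l] [[[i' j'] k'] l'] /=.
  move=> HG HF H4 H3.
  have /invr_inj/qpow_inj eG : q ^- (3 * j + 3 * k) = q ^- (3 * j' + 3 * k').
    by apply: HG => -[[[? ?] ?] ?]; exact: seedmon_minorG.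
  have /qpow_inj eF : q ^+ (i + 3 * l) = q ^+ (i' + 3 * l').
    by apply: HF => -[[[? ?] ?] ?]; exact: seedmon_minorF.
  have /qpow_inj e4 : q ^+ (3 * i + 3 * l) = q ^+ (3 * i' + 3 * l').
    by apply: H4 => -[[[? ?] ?] ?]; exact: seedmon_E4.
  have /invr_inj/qpow_inj e3 : q ^- (3 * j + k) = q ^- (3 * j' + k').
    by apply: H3 => -[[[? ?] ?] ?]; exact: seedmon_E3.
  (* The four exponents determine the monomial: [e4] minus [eF] gives [2 i], [eG] minus [e3] gives
     [2 k], and then [l] and [j] follow. *)
  by congr (_, _, _, _); lia.
move=> m; rewrite inE => /orP[/eqP->|]; last exact: cs.
apply: contrapT => /eqP cn0; apply: (notin n); apply: (idealZ_inv MI cn0).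
by move: Mp; rewrite big_cons big_seq big1 ?addr0 // => k /cs ->; rewrite scale0r.
Qed.

Lemma seed_span_mod p : seed_span p -> M p -> p = 0.
Proof.
move=> [l ->]; rewrite lincomb_collect => Mp.
rewrite big_seq big1 // => m ml.
by rewrite (seedmon_indep (undup_uniq _) Mp ml) scale0r.
Qed.

Lemma seedmon_notin m : ~ M (seedmon m).
Proof.
move=> Mm; have := @seedmon_indep (fun=> 1) [:: m] isT.
by rewrite big_seq1 scale1r => /(_ Mm m (mem_head _ _)) /eqP; rewrite oner_eq0.
Qed.

End Regular.

Lemma maximal_subset (alpha beta : K) (I P : set B) : (alpha, beta) != (0, 0) ->
    two_sided_ideal I ->
    I (Omega1_expr q E - alpha%:A) -> I (Omega2_expr q E - beta%:A) ->
  maximal_two_sided_ideal P -> (I `<=` P)%classic -> (P `<=` I)%classic.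
Proof.
move=> ab0 II IO1 IO2 Pmax IP.
have [PI PT _] := Pmax; have [P0 PD Pl Pr] := PI; have [I0 ID Il Ir] := II.
(* Clearing denominators gives [seedmon m * x] congruent to some [p] modulo [I]; this [p] lies in
   [P] and in the seed span, so it vanishes by independence. *)
have torsion x : P x -> exists m, I (seedmon m * x).
  move=> Px; have [m [p [Qp Ip]]] := clearable_all II IO1 IO2 x.
  exists m; suff p0 : p = 0 by move: Ip; rewrite p0 subr0.
  apply: (seed_span_mod ab0 Pmax (IP _ IO1) (IP _ IO2)) => //.
  by apply: (ideal_subl PI (IP _ Ip)); apply: Pl.
have [l [lP lgen]] := right_noetherian uq_straighten uq_mon_span
  (And3 P0 PD Pr : right_ideal P).
(* A common denominator for finitely many generators works for all of [P], since the [x] with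
   [seedmon m * x] in [I] form a right ideal. *)
have [m mP] : exists m, forall x, P x -> I (seedmon m * x).
  have [m ml] : exists m, forall x, x \in l -> I (seedmon m * x).
    elim: l lP {lgen} => [|x l IHl] lP; first by exists (0, 0, 0, 0)%N.
    have [|m ml] := IHl; first by move=> y yl; apply: lP; rewrite inE yl orbT.
    have [n nx] := torsion x (lP x (mem_head _ _)).
    have [c c0 Ec] := seedmonM m n; have [e e0 Ee] := seedmonM n m.
    exists (seed_add m n) => y; rewrite inE => /orP[/eqP->|/ml my].
      by apply: (idealZ_inv II c0); rewrite scalerAl -Ec -mulrA; apply: Il.
    by apply: (idealZ_inv II e0); rewrite scalerAl seed_addC -Ee -mulrA; apply: Il.
  exists m; apply: lgen => //; split=> [|x y Ix Iy|a x Ix].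
  - by rewrite mulr0.
  - by rewrite mulrDr; apply: ID.
  - by rewrite mulrA; apply: Ir.
(* The left annihilator of [P] modulo [I], two-sided because [P] is. It contains [I] and
   [seedmon m]; were it proper, a maximal ideal above it would contradict [seedmon_notin]. *)
pose A : set B := [set a | forall p, P p -> I (a * p)]%classic.
have AI : two_sided_ideal A.
  split=> [p _|a b Aa Ab p Pp|b a Aa p Pp|b a Aa p Pp].
  - by rewrite mul0r.
  - by rewrite mulrDl; apply: ID; [apply: Aa|apply: Ab].
  - by rewrite -mulrA; apply/Il/Aa.
  - by rewrite -mulrA; apply/Aa/Pl.
have [A1 p Pp|A1] := pselect (A 1); first by rewrite -(mul1r p); apply: A1.
have [M Mmax AM] := exists_maximal AI A1.
have IM : (I `<=` M)%classic by move=> x Ix; apply: AM => p _; apply: Ir.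
case: (seedmon_notin ab0 Mmax (IM _ IO1) (IM _ IO2) (m := m)).
exact: AM.
Qed.

Lemma quotient_maximal (alpha beta : K) (I : set B) : (alpha, beta) != (0, 0) ->
    two_sided_ideal I -> ~ I 1 ->
    I (Omega1_expr q E - alpha%:A) -> I (Omega2_expr q E - beta%:A) ->
  maximal_two_sided_ideal I.
Proof.
move=> ab0 II I1 IO1 IO2; have [P Pmax IP] := exists_maximal II I1.
suff -> : I = P by [].
by apply/seteqP; split=> //; exact: (maximal_subset ab0 II IO1 IO2 Pmax IP).
Qed.

End MaximalIdeals.

(** * The presented algebra and its generators *)

Section ExpressionMorphisms.
Variables (K : fieldType) (q : K) (B C : lalgType K).
Variables (f : {lrmorphism B -> C}) (E : 'I_6 -> B).

(** A tuple of rewriting rules, so that a single [rewrite !fE] pushes [f] through a whole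
    expression. *)
Let fE : (forall x y, (f (x + y) = f x + f y)%R) * (forall x, (f (- x) = - f x)%R)
  * (forall x y, (f (x * y) = f x * f y)%R)
  * (forall (c : K) x, (f (c *: x) = c *: f x)%R)
  * (forall n, {morph f : x / x ^+ n >-> x ^+ n}).
Proof.
by refine (_, _, _, _, _) => [x y|x|x y|c x|n x];
  rewrite (rmorphD, rmorphN, rmorphM, linearZ_LR, rmorphXn).
Qed.

Lemma UqG2_relations_morph :
  UqG2_relations q (f \o E) = [seq (f r.1, f r.2) | r <- UqG2_relations q E].
Proof. by rewrite /= !fE. Qed.

Lemma Omega1_expr_morph : Omega1_expr q (f \o E) = f (Omega1_expr q E).
Proof. by rewrite /Omega1_expr /= !fE. Qed.

Lemma Omega2_expr_morph : Omega2_expr q (f \o E) = f (Omega2_expr q E).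
Proof. by rewrite /Omega2_expr /= !fE. Qed.

End ExpressionMorphisms.

Section Presentation.
Variables (K : fieldType) (q : K).

Lemma UqG2_rel r : r \in UqG2_relations q (@UqG2_gen K q) -> r.1 = r.2.
Proof.
rewrite [X in _ \in X](UqG2_relations_morph q (UqG2_pi q) (@UqG2_letter K)).
case/mapP=> t trel ->; apply/UqG2_piP => I [_ genI]; apply: genI.
by exists t.
Qed.

Lemma UqG2_generated (S : UqG2 q -> Prop) : S 1 ->
  (forall x y, S x -> S y -> S (x + y)) -> (forall x y, S x -> S y -> S (x * y)) ->
  (forall (c : K) x, S x -> S (c *: x)) -> (forall i, S (@UqG2_gen K q i)) ->
  forall x, S x.
Proof.
move=> S1 SD SM SZ Sgen x; rewrite -(UqG2_reprK x) (monalgE (UqG2_repr x)) raddf_sum.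
have Sword (w : seq 'I_6) : S (UqG2_pi q << FMonom w >>).
  elim: w => [|i w IHw]; first by rewrite -fmoneE; apply: S1.
  have -> : << FMonom (i :: w) >> = UqG2_letter K i * << FMonom w >>.
    by rewrite malgM_def fgmulUU mulr1 fmuE /mmul /= fmmulE.
  have -> : UqG2_pi q (UqG2_letter K i * << FMonom w >>) =
      UqG2_gen q i * UqG2_pi q << FMonom w >> by exact: rmorphM.
  exact: SM.
have Sterm c (k : {fmonom 'I_6}) : S (UqG2_pi q << c *g k >>).
  have -> : << c *g k >> = c *: << k >> :> {malg K[{fmonom 'I_6}]}.
    by rewrite -mul_malgC malgM_def fgmulUU mulr1 mul1m.
  have -> : UqG2_pi q (c *: << k >>) = c *: UqG2_pi q << k >> by exact: linearZ_LR.
  by apply: SZ; rewrite -(fmK k).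
apply: big_ind => [|//|k _]; last exact: Sterm.
by rewrite -(scale0r (1 : UqG2 q)); apply: SZ.
Qed.

End Presentation.
(** * The module of Laurent expansions *)

Delimit Scope Z_scope with bZ.

Section LaurentModule.
Variables (K : fieldType) (q : K) (alpha beta : K).
Hypotheses (q_neq0 : q != 0).
Hypothesis q_nru : forall n : nat, (0 < n)%N -> q ^+ n != 1.

Local Notation h := (q ^+ 4 + q ^+ 2 + 1).
Local Notation d := (q ^+ 2 - 1).

(** Binary integers compute: on closed exponents, evaluation produces numeral powers of [q] that
    [field] can treat. *)
Definition zexp (z : Z) : K := match z with
  | Z0 => 1
  | Zpos p => q ^+ Pos.to_nat p
  | Zneg p => q ^- Pos.to_nat p
  end.

Lemma zexpD x y : zexp (x + y)%bZ = zexp x * zexp y.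
Proof.
have zexpE z : zexp z = q ^ ssrZ.int_of_Z z.
  case: z => [|p|p] //=; rewrite /exprz prednK //.
  by apply/ltP; exact: Pos2Nat.is_pos.
rewrite !zexpE -exprzDr ?unitfE //; congr (q ^ _).
by apply: (can_inj ssrZ.Z_of_intK); lia.
Qed.

(* The key [(i, j, a, b)] encodes the operator
   [f |-> fun m n => q^(m i + n j) f (m + a) (n + b)] on functions on Z^2. *)
Definition opkey := (Z * Z * Z * Z)%type.
Definition op := seq (K * opkey).
Definition opterm (t : K * opkey) (f : Z -> Z -> K) (m n : Z) : K :=
  let: (c, (i, j, a, b)) := t in
  c * zexp (m * i + n * j)%bZ * f (m + a)%bZ (n + b)%bZ.
Definition opval (p : op) f m n : K := \sum_(t <- p) opterm t f m n.

Definition eqkey (k l : opkey) : bool :=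
  let: (i, j, a, b) := k in let: (i', j', a', b') := l in
  if Z.eqb i i' then if Z.eqb j j' then if Z.eqb a a' then Z.eqb b b'
  else false else false else false.

Fixpoint opadd1 c k (p : op) : op := match p with
  | [::] => [:: (c, k)]
  | (c', l) :: p' => if eqkey k l then (cadd c c', l) :: p'
                     else (c', l) :: opadd1 c k p'
  end.

Fixpoint opadd (p r : op) : op := match p with
  | [::] => r
  | (c, k) :: p' => opadd1 c k (opadd p' r)
  end.

Fixpoint opscale c (p : op) : op := match p with
  | [::] => [::]
  | (c', k) :: p' => (cmul c c', k) :: opscale c p'
  end.

(** The extra power of [q] comes from moving the shift by [(a, b)] past the multiplication by
    [q^(m i' + n j')]. *)
Fixpoint opmul1 (c : K) (k : opkey) (r : op) : op := match r with
  | [::] => [::]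
  | (c', k') :: r' =>
    let: (i, j, a, b) := k in let: (i', j', a', b') := k' in
    opadd1 (cmul (cmul c c') (zexp (a * i' + b * j')%bZ))
      (Z.add i i', Z.add j j', Z.add a a', Z.add b b') (opmul1 c k r')
  end.

Fixpoint opmul (p r : op) : op := match p with
  | [::] => [::]
  | (c, k) :: p' => opadd (opmul1 c k r) (opmul p' r)
  end.

Definition opone : op := [:: (cone K, (0, 0, 0, 0)%bZ)].

Fixpoint opexp (p : op) n : op := match n with
  | 0 => opone
  | n'.+1 => opmul p (opexp p n')
  end.

Lemma eqkeyP k l : eqkey k l -> k = l.
Proof.
case: k l => [[[i j] a] b] [[[i' j'] a'] b'] /=.
by do 4?[case: Z.eqb_spec => // ->].
Qed.

Lemma opval_cons c k p f m n :
  opval ((c, k) :: p) f m n = opterm (c, k) f m n + opval p f m n.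
Proof. exact: big_cons. Qed.

Lemma opval_nil f m n : opval [::] f m n = 0.
Proof. exact: big_nil. Qed.

Lemma optermD c c' k f m n :
  opterm (c + c', k) f m n = opterm (c, k) f m n + opterm (c', k) f m n.
Proof. by case: k => [[[i j] a] b] /=; rewrite !mulrDl. Qed.

Lemma opval_add1 c k p f m n :
  opval (opadd1 c k p) f m n = opterm (c, k) f m n + opval p f m n.
Proof.
elim: p => [|[c' l] p IHp] /=; first by rewrite opval_cons.
case: ifP => [/eqkeyP->|_]; rewrite !opval_cons; first by rewrite optermD addrA.
by rewrite IHp addrCA.
Qed.

Lemma opval_add p r f m n : opval (opadd p r) f m n = opval p f m n + opval r f m n.
Proof.
elim: p => [|[c k] p IHp] /=; first by rewrite opval_nil add0r.
by rewrite opval_add1 IHp opval_cons addrA.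
Qed.

Lemma opval_scale c p f m n : opval (opscale c p) f m n = c * opval p f m n.
Proof.
elim: p => [|[c' [[[i j] a] b]] p IHp] /=; first by rewrite opval_nil mulr0.
by rewrite !opval_cons IHp mulrDr /= !mulrA.
Qed.

Lemma opval_mul1 c k r f m n :
  opval (opmul1 c k r) f m n = opterm (c, k) (opval r f) m n.
Proof.
elim: r => [|[c' [[[i' j'] a'] b']] r IHr] /=.
  by case: k => [[[i j] a] b] /=; rewrite !opval_nil mulr0.
move: IHr; case: k => [[[i j] a] b] /= IHr.
rewrite opval_add1 IHr /= opval_cons mulrDr; congr (_ + _) => /=.
rewrite /cmul -!Z.add_assoc -!mulrA; congr (c * _); rewrite [in RHS]mulrCA; congr (c' * _).
rewrite !mulrA -!zexpD; congr (zexp _ * _); ring.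
Qed.

Lemma opval_mul p r f m n : opval (opmul p r) f m n = opval p (opval r f) m n.
Proof.
elim: p => [|[c k] p IHp] /=; first by rewrite !opval_nil.
by rewrite opval_add opval_mul1 IHp opval_cons.
Qed.

Lemma opval_one f m n : opval opone f m n = f m n.
Proof.
by rewrite opval_cons opval_nil addr0 /= !Z.mul_0_r !Z.add_0_r !mul1r.
Qed.

Lemma opval_sum (I : Type) (s : seq I) (c : I -> K) (f : I -> Z -> Z -> K) p m n :
  opval p (fun m n => \sum_(i <- s) c i * f i m n) m n =
  \sum_(i <- s) c i * opval p (f i) m n.
Proof.
under [RHS]eq_bigr do rewrite mulr_sumr.
rewrite exchange_big; apply: eq_bigr => -[e [[[i j] a] b]] _ /=.
by rewrite mulr_sumr; apply: eq_bigr => k _; rewrite mulrCA.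
Qed.

Lemma eq_opval p f g : f =2 g -> opval p f =2 opval p g.
Proof.
move=> fg m n; apply: eq_bigr => -[e [[[i j] a] b]] _ /=; by rewrite fg.
Qed.

(* [opE5] and [opE2] come from the definitions of [F] and [G]; [opE1] and [opE6]
   solve [Omega1 = E1 F - (q^2 / d) commF] and
   [Omega2 = G E6 + (q^6 / (d h)) commG]; [opGc] is [commG], by [commG_E4]. *)
Definition opE3 : op := [:: (cone K, (0, 0, 3, 1)%bZ)].
Definition opE4 : op := [:: (cone K, (1, 0, 0, 0)%bZ)].
Definition opF : op := [:: (cone K, (0, 1, 0, 0)%bZ)].
(** [opE4] and [opF] multiply by [q^m] and [q^n]. The shifts [(3, 1)] of [opE3] and [(3, 3)] of
    [opG] are the exponents in [E3 E4 = q^3 E4 E3], [E3 F = q F E3], [G E4 = q^3 E4 G] and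
    [G F = q^3 F G]. *)
Definition opG : op := [:: (cone K, (0, 0, 3, 3)%bZ)].
Definition opE3V : op := [:: (cone K, (0, 0, -3, -1)%bZ)].
Definition opE4V : op := [:: (cone K, (-1, 0, 0, 0)%bZ)].
Definition opFV : op := [:: (cone K, (0, -1, 0, 0)%bZ)].
Definition opGV : op := [:: (cone K, (0, 0, -3, -3)%bZ)].
Definition opE5 := opmul opE3V (opadd opF (opscale (h / d) opE4)).
Definition opE2 :=
  opmul (opadd opG (opscale (q ^+ 9 * d / h ^+ 2) (opexp opE3 3))) opE4V.
Definition opFc := opadd (opscale (h / q ^+ 2) (opmul opE2 opE5))
  (opscale (- q ^+ 4) (opexp opE3 2)).
Definition opGc := opmul (opadd
  (opscale (- q ^+ 6 * d ^+ 3 / h ^+ 3) (opexp opF 3))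
  (opscale (- (d ^+ 2 / (q ^+ 6 * h))) (opmul opG (opexp opE5 3)))) opE4V.
Definition opE1 :=
  opmul (opadd (opscale alpha opone) (opscale (q ^+ 2 / d) opFc)) opFV.
Definition opE6 := opmul opGV
  (opadd (opscale beta opone) (opscale (- (q ^+ 6 / (d * h))) opGc)).

Definition opgen (k : nat) : op := match k with
  | 0 => opE1 | 1 => opE2 | 2 => opE3 | 3 => opE4 | 4 => opE5 | _ => opE6
  end.

Fixpoint opexpand (e : ncexpr K) : op := match e with
  | NcOne => opone
  | NcGen k => opgen k
  | NcAdd e f => opadd (opexpand e) (opexpand f)
  | NcOpp e => opscale (copp (cone K)) (opexpand e)
  | NcMul e f => opmul (opexpand e) (opexpand f)
  | NcScale c e => opscale c (opexpand e)
  | NcPow e n => opexp (opexpand e) n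
  end.

Fixpoint opzero (p : op) : Prop := match p with
  | [::] => True
  | (c, _) :: p' => c = 0 /\ opzero p'
  end.

Lemma opzeroP p f m n : opzero p -> opval p f m n = 0.
Proof.
elim: p => [|[c [[[i j] a] b]] p IHp] /=; first by rewrite opval_nil.
by case=> -> /IHp E; rewrite opval_cons /= E !mul0r addr0.
Qed.

(** * The action of the free algebra on functions on [Z^2] *)

Local Notation free := {malg K[{fmonom 'I_6}]}.

Definition word_act (w : seq 'I_6) (f : Z -> Z -> K) :=
  foldr (fun (i : 'I_6) g => opval (opgen i) g) f w.

(** Taken at a single point [(m, n)], the action is the linear extension of a scalar-valued function
    of words. *)
Definition free_act (x : free) f m n : K :=
  mmap (@idfun K) (fun k : {fmonom 'I_6} => word_act (fmonom_val k) f m n) x.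

Lemma free_actU (c : K) k f m n :
  free_act << c *g k >> f m n = c * word_act (fmonom_val k) f m n.
Proof. by rewrite /free_act mmapU. Qed.

Lemma free_actB x y f m n : free_act (x - y) f m n = free_act x f m n - free_act y f m n.
Proof. exact: mmapB. Qed.

Lemma free_actD x y f m n : free_act (x + y) f m n = free_act x f m n + free_act y f m n.
Proof. exact: mmapD. Qed.

Lemma free_act_sum (I : Type) (s : seq I) (F : I -> free) f m n :
  free_act (\sum_(i <- s) F i) f m n = \sum_(i <- s) free_act (F i) f m n.
Proof. exact: raddf_sum. Qed.

Lemma word_act_sum (I : Type) (s : seq I) (c : I -> K) (f : I -> Z -> Z -> K) w :
  word_act w (fun m n => \sum_(i <- s) c i * f i m n) =2
  (fun m n => \sum_(i <- s) c i * word_act w (f i) m n).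
Proof.
elim: w => [|i w IHw] m n //=.
by rewrite (eq_opval _ IHw) opval_sum.
Qed.

Lemma free_actE x f m n :
  free_act x f m n = \sum_(k <- msupp x) x@_k * word_act (fmonom_val k) f m n.
Proof. exact: mmapE. Qed.

(** Each word acts linearly, and a concatenation of words acts as the composite; both factors are
    expanded over their supports. *)
Lemma free_actM x y f m n : free_act (x * y) f m n = free_act x (free_act y f) m n.
Proof.
rewrite malgM_def fgmull free_act_sum free_actE; apply: eq_bigr => k _.
have E : free_act y f =2
    (fun m n => \sum_(l <- msupp y) y@_l * word_act (fmonom_val l) f m n).
  by move=> m' n'; exact: free_actE.
rewrite free_act_sum.
have -> : word_act (fmonom_val k) (free_act y f) m n =
    \sum_(l <- msupp y) y@_l * word_act (fmonom_val k) (word_act (fmonom_val l) f) m n.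
  rewrite -word_act_sum; elim: (fmonom_val k) m n => [|i w IHw] m n /=; first exact: E.
  exact: eq_opval.
rewrite mulr_sumr; apply: eq_bigr => l _.
by rewrite free_actU fmM /word_act foldr_cat mulrA.
Qed.

Lemma free_actZ (c : K) x f m n : free_act (c *: x) f m n = c * free_act x f m n.
Proof.
by rewrite -mul_malgC free_actM free_actU fm1.
Qed.

Lemma free_act0 f m n : free_act 0 f m n = 0.
Proof. exact: mmap0. Qed.

Lemma free_act1 f m n : free_act 1 f m n = f m n.
Proof. by rewrite free_actU mul1r fm1. Qed.

Lemma eq_free_act x f g : f =2 g -> free_act x f =2 free_act x g.
Proof.
move=> fg m n; rewrite !free_actE; apply: eq_bigr => k _; congr (_ * _).
by elim: (fmonom_val k) m n => [|i w IHw] m n /=; [apply: fg|apply: eq_opval].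
Qed.

Lemma free_act_letter k f :
  free_act (letter (@UqG2_letter K) k) f =2 opval (opgen k) f.
Proof.
move=> m n.
by case: k => [|[|[|[|[|k]]]]] /=; rewrite free_actU mul1r fmU.
Qed.

Lemma free_act_denote e f :
  free_act (ncdenote (letter (@UqG2_letter K)) e) f =2 opval (opexpand e) f.
Proof.
elim: e f => [|k|e IHe e' IHe'|e IHe|e IHe e' IHe'|c e IHe|e IHe k] f m n /=.
- by rewrite free_act1 opval_one.
- exact: free_act_letter.
- by rewrite free_actD opval_add IHe IHe'.
- by rewrite -scaleN1r free_actZ opval_scale IHe.
- by rewrite free_actM opval_mul IHe; apply: eq_opval => m' n'; apply: IHe'.
- by rewrite free_actZ opval_scale IHe.
- elim: k m n => [|k IHk] m n /=; first by rewrite free_act1 opval_one.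
  by rewrite exprS free_actM opval_mul IHe; apply: eq_opval.
Qed.

Lemma free_act_eq0 e : opzero (opexpand e) ->
  forall f m n, free_act (ncdenote (letter (@UqG2_letter K)) e) f m n = 0.
Proof. by move=> e0 f m n; rewrite free_act_denote opzeroP. Qed.

Ltac op_reduce :=
  cbv beta iota zeta delta [opexpand opgen opE1 opE2 opE3 opE4 opE5 opE6 opF opG
    opE3V opE4V opFV opGV opFc opGc opone opexp opmul opmul1 opscale opadd opadd1
    eqkey opzero zexp
    Z.add Z.mul Z.opp Z.pos_sub Z.double Z.succ_double Z.pred_double Z.eqb
    Pos.add Pos.add_carry Pos.succ Pos.mul Pos.pred_double Pos.eqb
    Pos.to_nat Pos.iter_op Nat.add];
  rewrite /cadd /cmul /copp /cone.

Ltac op_solve :=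
  lazymatch goal with |- free_act ?t ?f ?m ?n = 0 =>
    let e := nc_quote K t in refine (free_act_eq0 (e := e) _ f m n)
  end;
  op_reduce; repeat split; field;
  rewrite ?q_neq0 ?(qint2_neq0 q_nru) ?(qint3_neq0 q_nru) ?(qint6_neq0 q_nru)
    ?(qint2_opp_neq0 q_nru) ?andbT //.

Lemma free_act_relations r : r \in UqG2_relations q (@UqG2_letter K) ->
  forall f m n, free_act (r.1 - r.2) f m n = 0.
Proof.
by rewrite !inE; do ?[case/orP]; move/eqP=> -> f m n; rewrite [fst _]/= [snd _]/=; op_solve.
Qed.

Lemma free_act_Omega1 f m n :
  free_act (Omega1_expr q (@UqG2_letter K) - alpha%:A) f m n = 0.
Proof. rewrite /Omega1_expr /=; op_solve. Qed.

Lemma free_act_Omega2 f m n :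
  free_act (Omega2_expr q (@UqG2_letter K) - beta%:A) f m n = 0.
Proof. rewrite /Omega2_expr /=; op_solve. Qed.

Lemma free_act_ideal :
  two_sided_ideal [set x | forall f m n, free_act x f m n = 0]%classic.
Proof.
split=> [f m n|x y /= x0 y0 f m n|a x /= x0 f m n|a x /= x0 f m n].
- exact: free_act0.
- by rewrite free_actD x0 y0 addr0.
- rewrite free_actM (@eq_free_act _ _ (free_act 0 f)) => [|m' n'].
    by rewrite -free_actM mulr0 free_act0.
  by rewrite x0 free_act0.
- by rewrite free_actM x0.
Qed.

Lemma free_act_kernel x : UqG2_kernel q x -> forall f m n, free_act x f m n = 0.
Proof.
move=> kx; apply: (kx [set x | forall f m n, free_act x f m n = 0]%classic).
split; first exact: free_act_ideal.
by move=> _ [r rrel <-]; apply: free_act_relations.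
Qed.

Lemma free_act_repr x f m n : free_act (UqG2_repr (UqG2_pi q x)) f m n = free_act x f m n.
Proof.
apply/subr0_eq; rewrite -free_actB; apply: free_act_kernel.
exact: UqG2_kernel_repr.
Qed.

(** The elements acting by zero form a two-sided ideal that contains both generators, whereas [1]
    fixes the constant function [1]. By [free_act_repr] the choice of representatives does not
    affect the action. *)
Lemma Omega_ideal_proper :
  ~ ideal_gen [set Omega1 q - alpha%:A; Omega2 q - beta%:A]%classic (1 : UqG2 q).
Proof.
pose W : set (UqG2 q) := [set y | forall f m n, free_act (UqG2_repr y) f m n = 0]%classic.
have piW x : W (UqG2_pi q x) <-> forall f m n, free_act x f m n = 0.
  by split=> Wx f m n; have := Wx f m n; rewrite free_act_repr.
move=> /(_ W) W1; suff : W 1.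
  move/(piW 1)/(_ (fun _ _ => 1) 0%bZ 0%bZ); rewrite free_act1 => /eqP.
  by rewrite oner_eq0.
apply: W1; split.
  have [W0 WD Wl Wr] := free_act_ideal; split.
  - by rewrite /= -(raddf0 (UqG2_pi q)); apply/piW.
  - move=> x y; rewrite -(UqG2_reprK x) -(UqG2_reprK y) -raddfD.
    by move=> /piW Wx /piW Wy; apply/piW/WD.
  - move=> a x; rewrite -(UqG2_reprK x) -(UqG2_reprK a) -rmorphM.
    by move=> /piW Wx; apply/piW/Wl.
  - move=> a x; rewrite -(UqG2_reprK x) -(UqG2_reprK a) -rmorphM.
    by move=> /piW Wx; apply/piW/Wr.
move=> _ /= [->|->].
  have -> : Omega1 q - alpha%:A = UqG2_pi q (Omega1_expr q (@UqG2_letter K) - alpha%:A).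
    rewrite raddfB /= -(Omega1_expr_morph q (UqG2_pi q)); congr (_ - _).
    by rewrite linearZ_LR /= rmorph1.
  exact/piW/free_act_Omega1.
have -> : Omega2 q - beta%:A = UqG2_pi q (Omega2_expr q (@UqG2_letter K) - beta%:A).
  rewrite raddfB /= -(Omega2_expr_morph q (UqG2_pi q)); congr (_ - _).
  by rewrite linearZ_LR /= rmorph1.
exact/piW/free_act_Omega2.
Qed.

End LaurentModule.

Unset Implicit Arguments.

Theorem theorem3p12 (K : fieldType) (q : K) (q_neq0 : q != 0)
    (q_not_root_of_unity : forall n : nat, (0 < n)%N -> q ^+ n != 1)
    (alpha beta : K) (alpha_beta_neq0 : (alpha, beta) != (0, 0)) :
  let I : set (UqG2 q) :=
    ideal_gen [set Omega1 q - alpha%:A; Omega2 q - beta%:A]%classic in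
  prime_two_sided_ideal I /\ maximal_two_sided_ideal I.
Proof.
move=> I; have Imax : maximal_two_sided_ideal I.
  apply: (quotient_maximal q_neq0 q_not_root_of_unity (@UqG2_rel K q)
    (@UqG2_generated K q) alpha_beta_neq0 (ideal_genP _)).
  - exact: Omega_ideal_proper.
  - by move=> J [_ JO]; apply: JO; left.
  - by move=> J [_ JO]; apply: JO; right.
by split=> //; apply: maximal_prime.
Qed.
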